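(* Consider the dilation-invariant functional $\lambda_1(g)V(g)^{2/n}$ on metrics $g$ on the topological $n$-torus. (1) When $n=3$, every flat metric $g$ on the topological $3$-torus satisfies $\lambda_1(g)V(g)^{2/3}\le 4\sqrt[3]{2}\,\pi^2$, and equality is attained by the ($\lambda_1$-minimal) flat torus $\mathbb{R}^3/\Lambda_3$ for which the dual lattice $\Lambda_3^*$ has, with respect to some basis, the Gram matrix (up to a scaling) $$\begin{pmatrix}1&-\frac12&0\\-\frac12&1&-\frac12\\0&-\frac12&1\end{pmatrix}.$$ (2) When $n=4$, every flat metric $g$ on the topological $4$-torus satisfies $\lambda_1(g)V(g)^{2/4}\le 4\sqrt{2}\,\pi^2$, and equality is attained by the ($\lambda_1$-minimal) flat torus $\mathbb{R}^4/\mathrm{Span}_{\mathbb{Z}}\{e_1-e_4,\ e_2-e_4,\ e_3-e_4,\ 2e_4\}$ (with metric a constant multiple of the Euclidean one), where $e_1,\dots,e_4$ is the standard basis of $\mathbb{R}^4$.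
   Context: For a closed Riemannian manifold $(M^n,g)$, $V(g)$ denotes its volume and $\lambda_1(g)$ the first positive eigenvalue of its Laplacian. A flat metric on the topological $n$-torus is one isometric to the quotient metric on $\mathbb{R}^n/\Lambda$ for a rank $n$ lattice $\Lambda\subset\mathbb{R}^n$. The dual lattice is $\Lambda^*=\{\xi\in\mathbb{R}^n:\langle\xi,v\rangle\in\mathbb{Z}\ \text{for all } v\in\Lambda\}$. A flat torus is called $\lambda_1$-minimal if, after a constant rescaling of its metric, it admits an isometric minimal immersion into some unit sphere all of whose coordinate functions are eigenfunctions for the first eigenvalue. *)

(* Defs.v *)
From HB Require Import structures.
From mathcomp Require Import all_boot all_order all_algebra.
From mathcomp Require Import all_classical all_reals all_analysis.
Set Implicit Arguments.
Unset Strict Implicit.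
Unset Printing Implicit Defensive.
Import Order.TTheory GRing.Theory Num.Theory.
Import numFieldNormedType.Exports.
Local Open Scope classical_set_scope.
Local Open Scope ring_scope.

(* A flat torus R^n/L is given by an invertible matrix B whose rows form a
   basis of the rank n lattice L.  Functions on R^n/L are L-periodic functions
   on R^n, and the quotient metric is read on R^n as the Euclidean metric. *)

Section FlatTorus.
Context {R : realType} {n : nat}.
Implicit Types (L : set 'rV[R]_n) (B D : 'M[R]_n) (f : 'rV[R]_n -> R).

Definition dot {m : nat} (u v : 'rV[R]_m) : R := \sum_i u 0 i * v 0 i.

Definition lattice B : set 'rV[R]_n :=
  [set v | exists z : 'rV[int]_n, v = map_mx intr z *m B].

Definition dual_lattice L : set 'rV[R]_n :=
  [set xi | forall v, L v -> dot xi v \is a Num.int].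

Definition lattice_basis L B : Prop := B \in unitmx /\ L = lattice B.

(* Riemannian volume of R^n/L, for L the lattice with basis B: the metric of
   R^n/L in the coordinates t |-> t *m B, t in [0, 1]^n, has the constant
   volume density sqrt (\det (B *m B^T)) = `|\det B|. *)
Definition volume B : R := `|\det B|.

Definition periodic {T : Type} L (f : 'rV[R]_n -> T) : Prop :=
  forall v, L v -> forall x, f (x + v) = f x.

Definition partial (i : 'I_n) f : 'rV[R]_n -> R :=
  fun x => 'D_(delta_mx 0 i) f x.

Fixpoint class_C (k : nat) f : Prop :=
  continuous f /\
  if k is k'.+1 then
    forall i : 'I_n, (forall x, derivable f x (delta_mx 0 i)) /\
                     class_C k' (partial i f)
  else True.

Definition smooth f : Prop := forall k, class_C k f.

Definition laplacian f : 'rV[R]_n -> R :=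
  fun x => \sum_i partial i (partial i f) x.

(* Sign convention: the Laplacian of R^n/L is the nonnegative operator
   - \sum_i d_i^2. *)
Definition eigenfunction L (l : R) f : Prop :=
  [/\ smooth f, periodic L f, exists x, f x != 0
    & forall x, - laplacian f x = l * f x].

Definition laplace_eigenvalue L (l : R) : Prop := exists f, eigenfunction L l f.

(* The spectrum is discrete, so this infimum is a minimum. *)
Definition lambda1 L : R := inf [set l | 0 < l /\ laplace_eigenvalue L l].

Definition lambda1_vol B : R :=
  lambda1 (lattice B) * volume B `^ (2 / n%:R).

Section Immersion.
Context {N : nat}.
Implicit Types u : 'rV[R]_n -> 'rV[R]_N.

Definition coordinate u (j : 'I_N) : 'rV[R]_n -> R := fun x => u x 0 j.

Definition partial_map (i : 'I_n) u : 'rV[R]_n -> 'rV[R]_N :=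
  fun x => \row_j partial i (coordinate u j) x.

Definition first_form u (x : 'rV[R]_n) : 'M[R]_n :=
  \matrix_(i, j) dot (partial_map i u x) (partial_map j u x).

(* Component of w normal to the image of u inside the unit sphere, i.e.
   orthogonal to u x and to all d_i u x, when `|u| = 1 and u is an immersion. *)
Definition normal_part u (x : 'rV[R]_n) (w : 'rV[R]_N) : 'rV[R]_N :=
  w - dot w (u x) *: u x
    - \sum_i \sum_j (invmx (first_form u x) i j * dot w (partial_map i u x))
                      *: partial_map j u x.

Definition second_form u (x : 'rV[R]_n) (i j : 'I_n) : 'rV[R]_N :=
  normal_part u x (partial_map i (partial_map j u) x).

Definition mean_curvature u (x : 'rV[R]_n) : 'rV[R]_N :=
  \sum_i \sum_j invmx (first_form u x) i j *: second_form u x i j.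

(* The immersion condition follows from first_form u x = 1%:M. *)
Definition lambda1_minimal_immersion L u : Prop :=
  [/\ periodic L u /\ (forall j, smooth (coordinate u j)),
      forall x, dot (u x) (u x) = 1,
      forall x, first_form u x = 1%:M,
      forall x, mean_curvature u x = 0
    & forall j, eigenfunction L (lambda1 L) (coordinate u j)].

End Immersion.

(* R^n/L with its metric multiplied by r ^+ 2 is isometric to R^n/(r L). *)
Definition lambda1_minimal B : Prop :=
  exists r : R, 0 < r /\
  exists (N : nat) (u : 'rV[R]_n -> 'rV[R]_N),
    lambda1_minimal_immersion (lattice (r *: B)) u.

Definition dual_has_gram B (G : 'M[R]_n) : Prop :=
  exists D : 'M[R]_n, lattice_basis (dual_lattice (lattice B)) D /\
  exists s : R, 0 < s /\ D *m D^T = s *: G.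

End FlatTorus.

Definition seqs_mx {R : realType} (n : nat) (s : seq (seq R)) : 'M[R]_n :=
  \matrix_(i, j) nth 0 (nth [::] s i) j.

Definition gram3 (R : realType) : 'M[R]_3 :=
  seqs_mx 3 [:: [::      1; - 2^-1;      0 ];
                [:: - 2^-1;      1; - 2^-1 ];
                [::      0; - 2^-1;      1 ] ].

(* rows e1 - e4, e2 - e4, e3 - e4, 2 e4 *)
Definition basis4 (R : realType) : 'M[R]_4 :=
  seqs_mx 4 [:: [:: 1; 0; 0; -1 ];
                [:: 0; 1; 0; -1 ];
                [:: 0; 0; 1; -1 ];
                [:: 0; 0; 0;  2 ] ].

(* Main.v *)
(** Upper bound: every dual lattice vector xi carries the eigenfunctions
    cos (2 pi xi.x + p), so lambda_1 / (4 pi^2) is at most the minimum of the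
    dual lattice, and one needs the Hermite constants in ranks 3 and 4.  In rank
    3, Selling reduction produces an obtuse superbase, for which 2 det - m^3 is
    a sum of products of nonnegative quantities.  Rank 4 follows by Mordell's
    argument: the vectors orthogonal to a primitive dual vector form a lattice
    of rank 3.

    Equality: both extremal lattices are homothetic to the dual of the root
    lattice D_n (n = 3, 4), that is, to the lattice spanned by an orthonormal
    frame and its half sum.  An eigenfunction which is not constant along a
    vector of the frame can be replaced by its odd part under a reflection; it
    then vanishes on the walls of a slab, and comparison with a product of
    cosines bounds its eigenvalue from below.  The minimal immersion is given by
    the waves attached to the roots of D_n, which form a tight frame. *)

From mathcomp Require Import all_boot all_order all_fingroup all_algebra.
From mathcomp Require Import all_classical all_reals all_analysis.
From mathcomp Require Import ring lra zify.
Require Import Defs.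
Set Implicit Arguments.
Unset Strict Implicit.
Unset Printing Implicit Defensive.
Import Order.TTheory GRing.Theory Num.Theory.
Import numFieldNormedType.Exports.
Local Open Scope classical_set_scope.
Local Open Scope ring_scope.

Section Dot.
Context {R : realType} {n : nat}.
Implicit Types (u v w : 'rV[R]_n) (a : R).

Lemma dotE u v : dot u v = (u *m v^T) 0 0.
Proof. by rewrite mxE; apply: eq_bigr => i _; rewrite mxE. Qed.

Lemma dotC u v : dot u v = dot v u.
Proof. by apply: eq_bigr => i _; rewrite mulrC. Qed.

Lemma dotDl u v w : dot (u + v) w = dot u w + dot v w.
Proof. by rewrite !dotE mulmxDl mxE. Qed.

Lemma dotDr u v w : dot u (v + w) = dot u v + dot u w.
Proof. by rewrite dotC dotDl !(dotC u). Qed.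

Lemma dotZl a u v : dot (a *: u) v = a * dot u v.
Proof. by rewrite !dotE -scalemxAl mxE. Qed.

Lemma dotZr a u v : dot u (a *: v) = a * dot u v.
Proof. by rewrite dotC dotZl dotC. Qed.

Lemma dot_suml (I : finType) (P : pred I) (F : I -> 'rV[R]_n) v :
  dot (\sum_(i | P i) F i) v = \sum_(i | P i) dot (F i) v.
Proof. by rewrite dotE mulmx_suml summxE; apply: eq_bigr => i _; rewrite dotE. Qed.

Lemma dot_sumr (I : finType) (P : pred I) u (F : I -> 'rV[R]_n) :
  dot u (\sum_(i | P i) F i) = \sum_(i | P i) dot u (F i).
Proof. by rewrite dotC dot_suml; apply: eq_bigr => i _; rewrite dotC. Qed.

Lemma dot_ge0 v : 0 <= dot v v.
Proof. by apply: sumr_ge0 => i _; rewrite -expr2 sqr_ge0. Qed.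

Lemma dot_eq0 v : (dot v v == 0) = (v == 0).
Proof.
apply/eqP/eqP => [v0|->]; last by rewrite dotE mul0mx mxE.
apply/rowP => i; rewrite mxE; apply/eqP; rewrite -sqrf_eq0 expr2.
by move/psumr_eq0P : v0 => -> // j _; rewrite -expr2 sqr_ge0.
Qed.

Lemma sqr_coord_le_dot v i : v 0 i ^+ 2 <= dot v v.
Proof.
by rewrite /dot (bigD1 i) //= -expr2 lerDl sumr_ge0 // => j _; rewrite -expr2 sqr_ge0.
Qed.

End Dot.

Notation intmx U := (map_mx intr U).

Section IntegerMatrix.
Context {R : realType}.

Lemma intmxM (m n p : nat) (U : 'M[int]_(m, n)) (V : 'M[int]_(n, p)) :
  intmx (U *m V) = intmx U *m intmx V :> 'M[R]_(m, p).
Proof. exact: (map_mxM intr). Qed.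

Lemma intmx_unit (n : nat) (U : 'M[int]_n) : U \in unitmx -> intmx U \in @unitmx R n.
Proof. by rewrite !unitmxE (det_map_mx intr); exact: (rmorph_unit intr). Qed.

Lemma sqr_det_intmx (n : nat) (U : 'M[int]_n) :
  U \in unitmx -> \det (intmx U : 'M[R]_n) ^+ 2 = 1.
Proof.
by rewrite unitmxE (det_map_mx intr) => /orP[]/eqP ->; rewrite ?sqrrN expr1n.
Qed.

Lemma row_intmxM (m n : nat) (U : 'M[int]_m) (A : 'M[R]_(m, n)) i :
  row i (intmx U *m A) = intmx (row i U) *m A.
Proof. by rewrite row_mul (map_row intr). Qed.

Lemma row_intmx (m n : nat) (A : 'M[R]_(m, n)) i :
  row i A = intmx (delta_mx 0 i) *m A.
Proof. by rewrite rowE (map_delta_mx intr). Qed.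

End IntegerMatrix.

Definition gram {R : realType} {m n : nat} (A : 'M[R]_(m, n)) : 'M[R]_m := A *m A^T.

Section Gram.
Context {R : realType} {m n : nat}.
Implicit Types A : 'M[R]_(m, n).

Lemma gramE A i j : gram A i j = dot (row i A) (row j A).
Proof. by rewrite !mxE; apply: eq_bigr => k _; rewrite !mxE. Qed.

Lemma gramC A i j : gram A i j = gram A j i.
Proof. by rewrite !gramE dotC. Qed.

Lemma sum_gram A (P : pred 'I_m) :
  \sum_(j | P j) \sum_(k | P k) gram A j k =
  dot (\sum_(k | P k) row k A) (\sum_(k | P k) row k A).
Proof.
rewrite dot_suml; apply: eq_bigr => j _; rewrite dot_sumr.
by apply: eq_bigr => k _; rewrite gramE.
Qed.

Lemma coord_le_tr_gram A i k : `|A i k| <= 1 + \tr (gram A).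
Proof.
have Aik2 : `|A i k| ^+ 2 <= \tr (gram A).
  rewrite real_normK ?num_real // /mxtrace (bigD1 i) //= gramE -[A i k]mulr1.
  rewrite ler_wpDr ?sumr_ge0 // => [j _|]; first by rewrite gramE dot_ge0.
  by have := sqr_coord_le_dot (row i A) k; rewrite mxE mulr1.
by have := sqr_ge0 (`|A i k| - 1); have := normr_ge0 (A i k); lra.
Qed.

Lemma gram_mull (p : nat) (U : 'M[R]_(p, m)) A : gram (U *m A) = U *m gram A *m U^T.
Proof. by rewrite /gram trmx_mul !mulmxA. Qed.

Lemma gramZ a A : gram (a *: A) = a ^+ 2 *: gram A.
Proof. by rewrite /gram linearZ /= -scalemxAl -scalemxAr scalerA expr2. Qed.

Lemma det_gram_intmx (U : 'M[int]_m) A :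
  U \in unitmx -> \det (gram (intmx U *m A)) = \det (gram A).
Proof.
by move=> uU; rewrite gram_mull !det_mulmx det_tr mulrAC -expr2 sqr_det_intmx // mul1r.
Qed.

End Gram.

Lemma det_gram (R : realType) (n : nat) (A : 'M[R]_n) : \det (gram A) = \det A ^+ 2.
Proof. by rewrite det_mulmx det_tr. Qed.

Lemma gram_unit (R : realType) (n : nat) (A : 'M[R]_n) :
  A \in unitmx -> gram A \in unitmx.
Proof. by move=> uA; rewrite unitmx_mul unitmx_tr uA. Qed.

Lemma det_gram_gt0 (R : realType) (n : nat) (A : 'M[R]_n) :
  A \in unitmx -> 0 < \det (gram A).
Proof. by rewrite det_gram exprn_even_gt0 //= -unitfE unitmxE. Qed.

Lemma unitmx_row_neq0 (R : comUnitRingType) (n : nat) (A : 'M[R]_n) i :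
  A \in unitmx -> row i A != 0.
Proof.
move=> uA; apply/eqP => Ai0; have := row1 R i.
rewrite -(mulmxV uA) row_mul Ai0 mul0mx => /rowP/(_ i).
by rewrite !mxE !eqxx => /eqP; rewrite eq_sym oner_eq0.
Qed.

Lemma gram_diag_gt0 (R : realType) (n : nat) (A : 'M[R]_n) i :
  A \in unitmx -> 0 < gram A i i.
Proof. by move=> uA; rewrite gramE lt_def dot_ge0 dot_eq0 unitmx_row_neq0. Qed.

Definition dual_basis {R : comUnitRingType} {n : nat} (A : 'M[R]_n) : 'M[R]_n :=
  (invmx A)^T.

Section DualBasis.
Context {R : comUnitRingType} {n : nat}.
Implicit Types A D : 'M[R]_n.

Lemma dual_basis_unit A : A \in unitmx -> dual_basis A \in unitmx.
Proof. by rewrite unitmx_tr unitmx_inv. Qed.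

Lemma dual_basisK : involutive (@dual_basis R n).
Proof. by move=> A; rewrite /dual_basis trmx_inv trmxK invmxK. Qed.

Lemma mulmx_tr_dual_basis A : A \in unitmx -> A *m (dual_basis A)^T = 1%:M.
Proof. by move=> uA; rewrite trmxK mulmxV. Qed.

Lemma eq_dual_basis A D : A *m D^T = 1%:M -> D = dual_basis A.
Proof.
move=> AD; have [uA _] := mulmx1_unit AD.
by apply: trmx_inj; rewrite trmxK -[LHS](mulKmx uA) AD mulmx1.
Qed.

Lemma dual_basisM A D : A \in unitmx -> D \in unitmx ->
  dual_basis (A *m D) = dual_basis A *m dual_basis D.
Proof.
move=> uA uD; apply/esym/eq_dual_basis.
by rewrite trmx_mul -mulmxA (mulmxA D) mulmx_tr_dual_basis // mul1mx mulmx_tr_dual_basis.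
Qed.

End DualBasis.

Lemma dual_basis_intmx (R : realType) (n : nat) (U : 'M[int]_n) :
  U \in unitmx -> dual_basis (intmx U) = intmx (dual_basis U) :> 'M[R]_n.
Proof.
move=> uU; apply/esym/eq_dual_basis.
by rewrite (map_trmx intr) -intmxM mulmx_tr_dual_basis // (map_mx1 intr).
Qed.

Lemma gram_dual_basis (R : realType) (n : nat) (A : 'M[R]_n) :
  A \in unitmx -> gram (dual_basis A) = invmx (gram A).
Proof.
move=> uA; apply: (can_inj (mulKmx (gram_unit uA))); rewrite mulmxV ?gram_unit //.
by rewrite /gram mulmxA -(mulmxA A) -trmx_mul mulVmx // trmx1 mulmx1 trmxK mulmxV.
Qed.

Lemma det_gram_dual_basis (R : realType) (n : nat) (A : 'M[R]_n) :
  \det (gram (dual_basis A)) = (\det (gram A))^-1.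
Proof. by rewrite !det_gram det_tr det_inv exprVn. Qed.

(** * Lattice minima *)

Section LatticeMinimum.
Context {R : realType}.

(* A lattice vector belongs to some basis if and only if it is primitive, so
   the infimum below is the least square norm of a non-zero lattice vector. *)
Definition basis_norms {m n : nat} (A : 'M[R]_(m, n)) : set R :=
  [set x | exists2 U : 'M[int]_m, U \in unitmx & exists i, x = gram (intmx U *m A) i i].

Definition lattice_min {m n : nat} (A : 'M[R]_(m, n)) : R := inf (basis_norms A).

Lemma lattice_min_le (m n : nat) (A : 'M[R]_(m, n)) (U : 'M[int]_m) i :
  U \in unitmx -> lattice_min A <= gram (intmx U *m A) i i.
Proof.
move=> uU; apply: ge_inf; last by exists U => //; exists i.
by exists 0 => x [V _ [j ->]]; rewrite gramE dot_ge0.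
Qed.

Lemma le_lattice_min (m n : nat) (A : 'M[R]_(m.+1, n)) (x : R) :
  (forall U : 'M[int]_m.+1, U \in unitmx -> forall i, x <= gram (intmx U *m A) i i) ->
  x <= lattice_min A.
Proof.
move=> xA; apply: lb_le_inf => [|_ [U uU [i ->]]]; last exact: xA.
by exists (gram (intmx 1%:M *m A) 0 0); exists 1%:M; [exact: unitmx1|exists 0].
Qed.

Lemma lattice_min_ge0 (m n : nat) (A : 'M[R]_(m.+1, n)) : 0 <= lattice_min A.
Proof. by apply: le_lattice_min => U _ i; rewrite gramE dot_ge0. Qed.

Lemma lattice_min_intmx (m n : nat) (U : 'M[int]_m) (A : 'M[R]_(m, n)) :
  U \in unitmx -> lattice_min (intmx U *m A) = lattice_min A.
Proof.
move=> uU; congr inf; apply/seteqP; split=> _ [V uV [i ->]].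
  by exists (V *m U); [rewrite unitmx_mul uV|exists i; rewrite intmxM mulmxA].
exists (V *m invmx U); first by rewrite unitmx_mul uV unitmx_inv.
by exists i; rewrite mulmxA -intmxM mulmxKV.
Qed.

Lemma lattice_min_row' (m n : nat) (A : 'M[R]_(m.+2, n)) :
  lattice_min A <= lattice_min (row' 0 A).
Proof.
apply: le_lattice_min => U uU i.
pose V : 'M[int]_(1 + m.+1) := lift0_mx U.
have uV : V \in unitmx by rewrite unitmxE det_lblock det1 mul1r.
suff -> : gram (intmx U *m row' 0 A) i i = gram (intmx V *m A) (lift 0 i) (lift 0 i).
  exact: lattice_min_le.
have V0 : V (lift 0 i) 0 = 0 by rewrite -rshift1 -(lshift0 m.+1 0) block_mxEdl mxE.
have VS k : V (lift 0 i) (lift 0 k) = U i k by rewrite -!rshift1 block_mxEdr.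
rewrite !gramE; suff -> : row (lift 0 i) (intmx V *m A) = row i (intmx U *m row' 0 A) by [].
rewrite !row_mul !mulmx_sum_row big_ord_recl mxE [intmx V _ _]mxE V0 scale0r add0r.
apply: eq_bigr => k _; rewrite [in LHS]mxE [intmx V _ _]mxE VS [in RHS]mxE [intmx U _ _]mxE.
by congr (_ *: _); apply/rowP => j; rewrite !mxE.
Qed.

End LatticeMinimum.

(** * Selling reduction and the Hermite constant in rank 3 *)

Section CoerciveMinimum.
Context {R : realType} {m n : nat}.
Variable A : 'M[R]_(m, n).
Hypothesis uA : gram A \in unitmx.

Lemma intmx_bounded (T : R) : exists b : nat, forall U : 'M[int]_m,
  \tr (gram (intmx U *m A)) <= T -> forall i j, `|U i j| <= b%:Z.
Proof.
pose X := A^T *m invmx (gram A).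
pose S : R := \sum_k \sum_j `|X k j|.
pose bound := (1 + T) * S.
exists (Num.bound `|bound|) => U; set W := intmx U *m A => trW i j.
have UE : intmx U = W *m X by rewrite /W /X -mulmxA (mulmxA A) mulmxV // mulmx1.
rewrite -(ler_int R) intr_norm.
have -> : (U i j)%:~R = (W *m X) i j :> R by rewrite -UE mxE.
apply: le_trans (le_trans (ler_norm bound) (ltW (archi_boundP (normr_ge0 _)))).
rewrite mxE; apply: le_trans (ler_norm_sum _ _ _) _.
rewrite /bound mulr_sumr; apply: ler_sum => k _; rewrite normrM.
apply: ler_pM => //; first by apply: le_trans (coord_le_tr_gram W i k) _; rewrite lerD2l.
by rewrite (bigD1 j) //= lerDl sumr_ge0.
Qed.

Lemma exists_min_unimodular (F : 'M[int]_m -> R) :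
  (forall U, \tr (gram (intmx U *m A)) <= F U) ->
  exists2 U, U \in unitmx & forall V, V \in unitmx -> F U <= F V.
Proof.
move=> trF; have [b bP] := intmx_bounded (F 1%:M).
have {bP}FP U : F U <= F 1%:M -> forall i j, `|U i j| <= b%:Z.
  by move=> FU; apply: bP; exact: le_trans FU.
pose decode (x : 'M['I_b.*2.+1]_m) : 'M[int]_m := \matrix_(i, j) ((x i j : nat)%:Z - b%:Z).
pose encode (U : 'M[int]_m) : 'M['I_b.*2.+1]_m := \matrix_(i, j) inord (absz (U i j + b%:Z)).
have encodeK U : F U <= F 1%:M -> decode (encode U) = U.
  move=> /FP bU; apply/matrixP => i j; have bUij := bU i j.
  by rewrite !mxE inordK; lia.
have unit1 : decode (encode 1%:M) \in unitmx by rewrite encodeK // unitmx1.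
case: (@arg_minP _ R _ (encode 1%:M) (fun x => decode x \in unitmx) (F \o decode) unit1).
move=> x ux xmin; exists (decode x) => // V uV.
have [FV|/ltW FV] := lerP (F V) (F 1%:M).
  by rewrite -(encodeK V FV); apply: xmin; rewrite encodeK.
by apply: le_trans FV; rewrite -[X in _ <= F X]encodeK //; apply: xmin.
Qed.

End CoerciveMinimum.

Lemma rank1_update_unitmx (R : comUnitRingType) (m : nat) (u : 'cV[R]_m) (i : 'I_m) :
  1 + u i 0 \is a GRing.unit -> 1%:M + u *m delta_mx 0 i \in unitmx.
Proof.
move=> ui; pose N := u *m delta_mx 0 i.
have NN : N *m N = u i 0 *: N.
  by rewrite /N mulmxA -(mulmxA u) -rowE [row i u]mx11_scalar mxE mul_mx_scalar scalemxAl.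
suff /mulmx1_unit[//] : (1%:M + N) *m (1%:M - (1 + u i 0)^-1 *: N) = 1%:M.
rewrite mulmxBr mulmx1 mulmxDl mul1mx -scalemxAr NN scalerA -scalerDl.
by rewrite -{1}[_^-1]mulr1 -mulrDr mulVr // scale1r addrK.
Qed.

Lemma lattice_min_le_sum (R : realType) (m n : nat) (A : 'M[R]_(m, n)) (P : pred 'I_m) i :
  P i -> lattice_min A <= \sum_(j | P j) \sum_(k | P k) gram A j k.
Proof.
move=> Pi; pose s : 'rV[int]_m := \row_k (P k && (k != i))%:R.
pose U : 'M[int]_m := 1%:M + delta_mx i 0 *m s.
have uU : U \in unitmx.
  rewrite -unitmx_tr [U^T]linearD /= trmx1 trmx_mul trmx_delta rank1_update_unitmx //.
  by rewrite !mxE eqxx andbF addr0.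
have UAi : row i (intmx U *m A) = \sum_(k | P k) row k A.
  rewrite row_intmxM mulmx_sum_row [RHS]big_mkcond; apply: eq_bigr => k _.
  rewrite !mxE big_ord1 !mxE !eqxx mul1r eq_sym.
  by have [->|_] := eqVneq k i; rewrite ?Pi ?andbF ?andbT; case: (P _);
    rewrite ?scale1r ?scale0r.
by rewrite sum_gram -UAi -gramE; exact: lattice_min_le.
Qed.

(* The sum of the square norms of the rows [w_1], ..., [w_m] of [W] and of
   [- (w_1 + ... + w_m)]. *)
Definition superbase_norm {R : realType} {m n : nat} (W : 'M[R]_(m, n)) : R :=
  \tr (gram W) + \sum_j \sum_k gram W j k.

Lemma superbase_normE (R : realType) (m n : nat) (W : 'M[R]_(m, n)) :
  superbase_norm W = \sum_k dot (row k W) (row k W) + dot (\sum_k row k W) (\sum_k row k W).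
Proof.
by congr (_ + _); [apply: eq_bigr => k _; rewrite gramE|exact: sum_gram].
Qed.

Lemma superbase_norm_rank1_update (R : realType) (m n : nat) (W : 'M[R]_(m, n))
    (u : 'cV[R]_m) (i : 'I_m) (s := \sum_k u k 0) :
  superbase_norm ((1%:M + u *m delta_mx 0 i) *m W) = superbase_norm W +
    (2 * \sum_k (u k 0 + s) * gram W k i + (\sum_k u k 0 ^+ 2 + s ^+ 2) * gram W i i).
Proof.
have rowU k : row k ((1%:M + u *m delta_mx 0 i) *m W) = row k W + u k 0 *: row i W.
  rewrite mulmxDl mul1mx raddfD /= -mulmxA row_mul -rowE; congr (_ + _).
  by apply/rowP => j; rewrite mxE big_ord1 !mxE.
rewrite !superbase_normE; under eq_bigr do rewrite rowU.
under [X in _ + dot X X]eq_bigr do rewrite rowU.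
rewrite big_split /= -scaler_suml -/s.
under eq_bigr do rewrite !(dotDl, dotDr, dotZl, dotZr) (dotC (row i W)).
under [X in _ = _ + (_ * X + _)]eq_bigr do rewrite mulrDl gramE.
rewrite !(dotDl, dotDr, dotZl, dotZr) (dotC (row i W)) gramE !big_split /=.
rewrite -mulr_sumr -dot_suml mulrDl mulr_suml.
under [X in _ + (_ + X) + _]eq_bigr do rewrite mulrA -expr2.
rewrite -!mulr_suml -/s; ring.
Qed.

(* The vectors with Gram matrix [G] have, together with minus their sum,
   pairwise nonpositive scalar products. *)
Definition obtuse {R : numDomainType} {m : nat} (G : 'M[R]_m) : Prop :=
  (forall i j, i != j -> G i j <= 0) /\ forall i, 0 <= \sum_j G i j.

(* The rows [w_k + u_k w_i] and minus their sum form a new superbase.  Taking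
   [u_j = 0] and [u_k = 1] gives Selling's move on the pair (i, j), and taking
   both equal to 1 gives his move on the pair formed by [w_i] and minus the sum. *)
Lemma obtuse_of_descent (R : realFieldType) (G : 'M[R]_3) :
  (forall i j, G i j = G j i) ->
  (forall (u : 'cV[int]_3) i (v := intmx u : 'cV[R]_3), u i 0 = -2 ->
    0 <= 2 * \sum_k (v k 0 + \sum_l v l 0) * G k i
         + (\sum_k v k 0 ^+ 2 + (\sum_k v k 0) ^+ 2) * G i i) ->
  obtuse G.
Proof.
move=> GC descent.
pose g i j := G (inord i) (inord j).
have gE i j : G i j = g i j by rewrite /g !inord_val.
have gC i j : g i j = g j i by exact: GC.
have [g01 g02 g12] := And3 (gC 0 1) (gC 0 2) (gC 1 2).
split=> [i j ij|i].
  have := descent (\col_k (if k == i then -2 else (k != j)%:R)) i.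
  rewrite mxE eqxx => /(_ erefl); rewrite !big_ord_recl !big_ord0 !mxE !gE.
  by case: i j ij => [[|[|[|i]]] hi] // [[|[|[|j]]] hj] // _; rewrite /= /bump /= !add1n; lra.
have := descent (\col_k (if k == i then -2 else 1)) i.
rewrite mxE eqxx => /(_ erefl); rewrite !big_ord_recl !big_ord0 !mxE !gE.
by case: i => [[|[|[|i]]] hi] //; rewrite /= /bump /= !add1n; lra.
Qed.

Lemma exists_obtuse_basis (R : realType) (n : nat) (A : 'M[R]_(3, n)) :
  gram A \in unitmx ->
  exists2 U : 'M[int]_3, U \in unitmx & obtuse (gram (intmx U *m A)).
Proof.
move=> uA.
have [U|U uU Umin] := @exists_min_unimodular _ _ _ A uA (fun U => superbase_norm (intmx U *m A)).
  by rewrite lerDl sum_gram dot_ge0.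
exists U => //; apply: obtuse_of_descent => [i j|u i v ui]; first exact: gramC.
have /Umin : (1%:M + u *m delta_mx 0 i) *m U \in unitmx.
  by rewrite unitmx_mul uU rank1_update_unitmx ?ui.
rewrite intmxM -mulmxA (map_mxD intr) (map_mx1 intr) intmxM (map_delta_mx intr).
by rewrite superbase_norm_rank1_update lerDl.
Qed.

(* Each [p_ij] is minus the scalar product of two of the four vectors of an
   obtuse superbase; the seven bounds are the square norms of the sums over the
   non-trivial subsets of the superbase, and the conclusion compares [m ^+ 3]
   with the sum over the spanning trees of the complete graph on four vertices,
   which is the determinant of the lattice. *)
Lemma obtuse_superbase_bound (R : realFieldType) (m p01 p02 p03 p12 p13 p23 : R) :
  [/\ 0 <= m, 0 <= p01, 0 <= p02 & 0 <= p03] -> [/\ 0 <= p12, 0 <= p13 & 0 <= p23] ->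
  [/\ m <= p01 + p02 + p03, m <= p01 + p12 + p13, m <= p02 + p12 + p23
    & m <= p03 + p13 + p23] ->
  [/\ m <= p02 + p03 + p12 + p13, m <= p01 + p03 + p12 + p23
    & m <= p01 + p02 + p13 + p23] ->
  m ^+ 3 <= 2 * (p01 * p23 * (p02 + p03 + p12 + p13) + p02 * p13 * (p01 + p03 + p12 + p23)
                 + p03 * p12 * (p01 + p02 + p13 + p23)
                 + p01 * p02 * p03 + p01 * p12 * p13 + p02 * p12 * p23 + p03 * p13 * p23).
Proof.
move=> [m_ge0 p01_ge0 p02_ge0 p03_ge0] [p12_ge0 p13_ge0 p23_ge0] [? ? ? ?] [? ? ?].
pose star s a b c :=
  (s - m) * (2 * (m * (a + b + c)) + 8 * (a * b + a * c + b * c) + 3 * m ^+ 2).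
pose split t a b := (t - m) * (2 * (m * (a + b)) + 8 * (a * b)).
have star_ge0 s a b c : m <= s -> 0 <= a -> 0 <= b -> 0 <= c -> 0 <= star s a b c.
  move=> ms a0 b0 c0; rewrite mulr_ge0 ?subr_ge0 //.
  by rewrite !addr_ge0 ?mulr_ge0 ?exprn_ge0 ?addr_ge0 ?mulr_ge0.
have split_ge0 t a b : m <= t -> 0 <= a -> 0 <= b -> 0 <= split t a b.
  by move=> mt a0 b0; rewrite mulr_ge0 ?subr_ge0 // !addr_ge0 ?mulr_ge0 ?addr_ge0.
rewrite -subr_ge0 -(pmulr_rge0 _ (ltr0n R 12)).
rewrite [X in 0 <= X](_ : _ =
  star (p01 + p02 + p03) p12 p13 p23 + star (p01 + p12 + p13) p02 p03 p23
  + star (p02 + p12 + p23) p01 p03 p13 + star (p03 + p13 + p23) p01 p02 p12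
  + split (p02 + p03 + p12 + p13) p01 p23 + split (p01 + p03 + p12 + p23) p02 p13
  + split (p01 + p02 + p13 + p23) p03 p12); last by rewrite /star /split; ring.
by rewrite !addr_ge0 ?star_ge0 ?split_ge0.
Qed.

Lemma det_mx33 (R : comPzRingType) (A : 'M[R]_3) (a := fun i j => A (inord i) (inord j)) :
  \det A = a 0%N 0%N * (a 1%N 1%N * a 2%N 2%N - a 1%N 2%N * a 2%N 1%N)
         - a 0%N 1%N * (a 1%N 0%N * a 2%N 2%N - a 1%N 2%N * a 2%N 0%N)
         + a 0%N 2%N * (a 1%N 0%N * a 2%N 1%N - a 1%N 1%N * a 2%N 0%N).
Proof.
have aE i j : A i j = a i j by rewrite /a !inord_val.
move: a aE => a aE; rewrite (expand_det_row _ 0) !big_ord_recl big_ord0 /cofactor.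
do !rewrite (expand_det_row _ 0) !big_ord_recl big_ord0 /cofactor !det_mx11.
by rewrite !mxE !aE /= /bump /= -[(-1) ^+ (0 + _)]signr_odd /=; ring.
Qed.

Lemma det_obtuse_ge (R : realFieldType) (G : 'M[R]_3) (m : R) :
  0 <= m -> (forall i j, G i j = G j i) -> obtuse G ->
  (forall (P : pred 'I_3) i, P i -> m <= \sum_(j | P j) \sum_(k | P k) G j k) ->
  m ^+ 3 <= 2 * \det G.
Proof.
move=> m0 symG [obtuse_pair obtuse_sum] vonorm.
pose g i j := G (inord i) (inord j).
have gE i j : G i j = g i j by rewrite /g !inord_val.
have symg i j : g i j = g j i by exact: symG.
have [g10 g20 g21] := And3 (symg 1 0)%N (symg 2 0)%N (symg 2 1)%N.
have pair i j : (i < 3)%N -> (j < 3)%N -> i != j -> g i j <= 0.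
  by move=> i3 j3 ij; apply: obtuse_pair; rewrite -val_eqE /= !inordK.
pose s i := g i 0%N + g i 1%N + g i 2%N.
have sum i : (i < 3)%N -> 0 <= s i.
  move=> i3; have := obtuse_sum (inord i).
  by rewrite !big_ord_recl big_ord0 !gE inordK // addr0 addrA.
have norm K : has (gtn 3) K -> m <= \sum_(j < 3)
    (if val j \in K then \sum_(k < 3) (if val k \in K then g j k else 0) else 0).
  move=> /hasP[i iK i3]; have := vonorm (fun j => val j \in K) (Ordinal i3) iK.
  rewrite big_mkcond; congr (_ <= _); apply: eq_bigr => j _.
  by rewrite big_mkcond; under eq_bigr do rewrite gE.
have [n0 n1 n2] := And3 (norm [:: 0%N] isT) (norm [:: 1%N] isT) (norm [:: 2%N] isT).
have [n01 n02 n12] :=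
  And3 (norm [:: 0; 1]%N isT) (norm [:: 0; 2]%N isT) (norm [:: 1; 2]%N isT).
have n012 := norm [:: 0; 1; 2]%N isT.
rewrite !big_ord_recl !big_ord0 /= /bump /= ?add1n in n0 n1 n2 n01 n02 n12 n012.
have [g01_le0 g02_le0 g12_le0] :=
  And3 (pair 0 1 isT isT isT)%N (pair 0 2 isT isT isT)%N (pair 1 2 isT isT isT)%N.
have [sum0 sum1 sum2] := And3 (sum 0 isT)%N (sum 1 isT)%N (sum 2 isT)%N.
have bound := @obtuse_superbase_bound _ m (s 0%N) (s 1%N) (s 2%N)
  (- g 0%N 1%N) (- g 0%N 2%N) (- g 1%N 2%N).
rewrite /s in sum0 sum1 sum2 bound.
apply: le_trans (bound _ _ _ _) _; [by split; lra|by split; lra|by split; lra|by split; lra|].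
by rewrite det_mx33 -!/(g _ _) g10 g20 g21; lra.
Qed.

Theorem hermite_rank3 (R : realType) (n : nat) (A : 'M[R]_(3, n)) :
  gram A \in unitmx -> lattice_min A ^+ 3 <= 2 * \det (gram A).
Proof.
move=> uA; have [U uU obtuseUA] := exists_obtuse_basis uA.
rewrite -(lattice_min_intmx A uU) -(det_gram_intmx A uU).
apply: det_obtuse_ge => //; [exact: lattice_min_ge0|exact: gramC|].
by move=> P i; exact: lattice_min_le_sum.
Qed.

(** * Mordell's inequality and the Hermite constant in rank 4 *)

Lemma det_gram_row' (R : realType) (n : nat) (A : 'M[R]_n.+1) : A \in unitmx ->
  \det (gram (row' 0 A)) = \det (gram A) * gram (dual_basis A) 0 0.
Proof.
move=> uA; have uG := gram_unit uA.
rewrite gram_dual_basis // /invmx uG !mxE /cofactor expr0 mul1r mulrA divff ?mul1r.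
  by congr (\det _); apply/matrixP => i j; rewrite !mxE; apply: eq_bigr => k _; rewrite !mxE.
by rewrite -unitfE -unitmxE.
Qed.

Section Mordell.
Context {R : realType} {n : nat}.
Variable gamma : R.
Hypothesis gamma_gt0 : 0 < gamma.
Hypothesis hermite : forall A : 'M[R]_(n.+1, n.+2),
  gram A \in unitmx -> lattice_min A ^+ n.+1 <= gamma * \det (gram A).
Implicit Types A : 'M[R]_n.+2.

(* The vectors of a lattice that are orthogonal to a primitive dual vector form
   a lattice of corank 1, to which the Hermite bound applies. *)
Lemma mordell_section A : A \in unitmx ->
  lattice_min A ^+ n.+1 <= gamma * \det (gram A) * gram (dual_basis A) 0 0.
Proof.
move=> uA; rewrite -mulrA -det_gram_row' //.
apply: le_trans (hermite _); last first.
  rewrite unitmxE unitfE det_gram_row' // mulf_neq0 // gt_eqF ?det_gram_gt0 //.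
  by rewrite gram_diag_gt0 ?dual_basis_unit.
by rewrite lerXn2r ?nnegrE ?lattice_min_ge0 // lattice_min_row'.
Qed.

Lemma mordell_dual A : A \in unitmx ->
  lattice_min A ^+ n.+1 <= gamma * \det (gram A) * lattice_min (dual_basis A).
Proof.
move=> uA; have c0 : 0 < gamma * \det (gram A) by rewrite mulr_gt0 ?det_gram_gt0.
rewrite -ler_pdivrMl //; apply: le_lattice_min => U uU i; rewrite ler_pdivrMl //.
pose V := perm_mx (tperm 0 i) *m U.
have uV : V \in unitmx by rewrite unitmx_mul unitmx_perm.
have uW := dual_basis_unit uV.
have -> : gram (intmx U *m dual_basis A) i i = gram (intmx V *m dual_basis A) 0 0.
  rewrite !gramE /V intmxM -mulmxA (map_perm_mx intr) -row_permE.
  by congr dot; apply/rowP => j; rewrite !mxE tpermL.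
have <- : dual_basis (intmx (dual_basis V) *m A) = intmx V *m dual_basis A.
  by rewrite dual_basisM ?intmx_unit // dual_basis_intmx // dual_basisK.
rewrite -(lattice_min_intmx A uW) -(det_gram_intmx A uW).
by apply: mordell_section; rewrite unitmx_mul intmx_unit.
Qed.

(* Eliminate the minimum of the dual lattice between [mordell_dual] for the
   lattice and for its dual. *)
Theorem mordell_inequality A : (0 < n)%N -> A \in unitmx ->
  lattice_min A ^+ (n * n.+2) <= gamma ^+ n.+2 * \det (gram A) ^+ n.
Proof.
move=> n0 uA; have d0 := det_gram_gt0 uA.
have := lattice_min_ge0 A; rewrite le_eqVlt => /orP[/eqP <-|m0].
  by rewrite expr0n muln_eq0 gtn_eqF //= mulr_ge0 // exprn_ge0 // ltW.
have primal := mordell_dual uA.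
have := mordell_dual (dual_basis_unit uA); rewrite dual_basisK det_gram_dual_basis.
have := lattice_min_ge0 (dual_basis A).
move: (lattice_min (dual_basis A)) (lattice_min A) (\det _) d0 m0 primal.
move=> m' m d d0 m0 primal m'0 dual.
rewrite -(ler_pM2r m0).
apply: le_trans (_ : (gamma * d * m') ^+ n.+1 <= _).
  have -> : m ^+ (n * n.+2) * m = (m ^+ n.+1) ^+ n.+1.
    by rewrite -exprSr -exprM; congr (_ ^+ _); lia.
  rewrite lerXn2r ?nnegrE ?exprn_ge0 ?(ltW m0) //.
  by rewrite mulr_ge0 // ltW // mulr_gt0.
rewrite exprMn; apply: le_trans (_ : (gamma * d) ^+ n.+1 * (gamma / d * m) <= _).
  by rewrite ler_pM2l // exprn_gt0 ?mulr_gt0.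
rewrite (_ : _ * (gamma / d * m) = gamma ^+ n.+2 * d ^+ n * m) //.
by rewrite exprMn !exprS; field; rewrite gt_eqF.
Qed.

End Mordell.

Theorem hermite_rank4 (R : realType) (A : 'M[R]_4) :
  A \in unitmx -> lattice_min A ^+ 4 <= 4 * \det (gram A).
Proof.
move=> uA; have := mordell_inequality (ltr0n R 2) (@hermite_rank3 R 4) isT uA.
have -> : 2 ^+ 4 * \det (gram A) ^+ 2 = (4 * \det (gram A)) ^+ 2 by ring.
rewrite (exprM _ 4 2) ler_sqr // nnegrE ?exprn_ge0 ?lattice_min_ge0 //.
by rewrite mulr_ge0 // ltW // det_gram_gt0.
Qed.

(** * Functions with continuous partial derivatives *)

Lemma is_derive_line (R : realType) (n : nat) (f : 'rV[R]_n -> R)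
    (x v : 'rV[R]_n) (t d : R) :
  is_derive t 1 (fun h : R => f (x + h *: v)) d <-> is_derive (x + t *: v) v f d.
Proof.
have quotientE : (fun h : R => h^-1 *: (((fun h => f (x + h *: v)) \o shift t) (h *: 1)
                                - f (x + t *: v))) =
    (fun h => h^-1 *: ((f \o shift (x + t *: v)) (h *: v) - f (x + t *: v))).
  apply/funext => h /=; congr (_ *: (f _ - _)).
  by rewrite [h *: 1]mulr1 scalerDl addrCA.
by split=> -[]; rewrite /derivable /derive /= => d1 d2; apply: DeriveDef;
  rewrite /derivable /derive /= ?quotientE // -quotientE.
Qed.

Lemma is_derive_line0 (R : realType) (n : nat) (f : 'rV[R]_n -> R) (x v : 'rV[R]_n) (d : R) :
  is_derive (0 : R) 1 (fun h : R => f (x + h *: v)) d <-> is_derive x v f d.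
Proof. by have := @is_derive_line R n f x v 0 d; rewrite scale0r addr0. Qed.

Lemma is_derive_continuous (R : realType) (f f' : R -> R) :
  (forall x : R, is_derive x 1 f (f' x)) -> continuous f.
Proof.
move=> df x; apply: differentiable_continuous; apply/derivable1_diffP.
exact: (ex_derive (is_derive := df x)).
Qed.

Lemma mean_value (R : realType) (f f' : R -> R) (a b : R) :
  (forall x : R, is_derive x 1 f (f' x)) ->
  exists2 s, `|s - a| <= `|b - a| & f b - f a = f' s * (b - a).
Proof.
move=> df.
have cf u v : {within `[u, v], continuous f}.
  by apply: continuous_subspaceT; exact: is_derive_continuous df.
have [ab|/ltW ba] := leP a b.
  have [s /itvP sab increment] := MVT_segment ab (fun x _ => df x) (cf _ _).
  by exists s => //; rewrite !ger0_norm ?subr_ge0 ?sab // lerD2r sab.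
have [s /itvP sba increment] := MVT_segment ba (fun x _ => df x) (cf _ _).
exists s; last by rewrite -[LHS]opprB increment -mulrN opprB.
by rewrite distrC [`|b - a|]distrC !ger0_norm ?subr_ge0 ?sba // lerD2l lerN2 sba.
Qed.

Section DirectionalDerivative.
Context {R : realType} {n : nat}.
Implicit Types (f g : 'rV[R]_n -> R) (x v e : 'rV[R]_n).

Lemma cvg_moving_quotient f g x v e (c : R) :
  (forall y, is_derive y e f (g y)) -> {for x, continuous g} ->
  h^-1 * (f (h *: (v + c *: e) + x) - f (h *: v + x)) @[h --> 0^'] --> c * g x.
Proof.
move=> de cg; apply/cvgrPdist_le => eps eps0.
have eps'0 : 0 < eps / (`|c| + 1) by rewrite divr_gt0 // ltr_wpDl.
have /cvgrPdist_le/(_ _ eps'0)/nbhs_ballP[r /= r0 hr] := cg.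
pose M := `|v| + `|c| * `|e| + 1.
have M0 : 0 < M by rewrite ltr_wpDl // addr_ge0 // mulr_ge0.
near=> h.
have h0 : h != 0 by near: h; exact: nbhs_dnbhs_neq.
have hM : `|h| * M < r.
  by rewrite -ltr_pdivlMr //; near: h; apply: dnbhs0_lt; exact: divr_gt0.
pose y s := h *: v + x + s *: e.
have dy (s : R) : is_derive s 1 (f \o y) (g (y s)) by apply/is_derive_line.
have [s sh increment] := mean_value 0 (h * c) dy.
have -> : f (h *: (v + c *: e) + x) - f (h *: v + x) = (f \o y) (h * c) - (f \o y) 0.
  by rewrite /y /= scale0r addr0 scalerDr scalerA addrAC.
rewrite increment subr0 mulrCA mulKf // mulrC -mulrBl normrM.
apply: le_trans (_ : eps / (`|c| + 1) * `|c| <= _); last first.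
  by rewrite mulrAC ler_pdivrMr ?ltr_wpDl // ler_pM2l // lerDl.
apply: ler_wpM2r => //; apply: hr; rewrite -ball_normE /= -normrN opprB.
rewrite (_ : y s - x = h *: v + s *: e); last by rewrite /y addrAC addrK.
apply: le_lt_trans hM; apply: le_trans (ler_normD _ _) _.
rewrite !normrZ /M mulrDr mulr1 mulrDr -addrA lerD2l.
apply: le_trans (_ : `|h| * (`|c| * `|e|) <= _); last by rewrite lerDl.
by rewrite mulrA ler_wpM2r // -normrM; move: sh; rewrite !subr0.
Unshelve. all: by end_near. Qed.

Lemma is_derive_dirD f g x v e (c d : R) :
  is_derive x v f d -> (forall y, is_derive y e f (g y)) ->
  {for x, continuous g} -> is_derive x (v + c *: e) f (d + c * g x).
Proof.
move=> dv de cg.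
have quotient : h^-1 * (f (h *: (v + c *: e) + x) - f x) @[h --> 0^'] --> d + c * g x.
  rewrite [d + _]addrC.
  have qv : h^-1 * (f (h *: v + x) - f x) @[h --> 0^'] --> d by case: dv => dv <-; exact: dv.
  apply: cvg_trans (cvgD (@cvg_moving_quotient f g x v e c de cg) qv); apply: near_eq_cvg.
  by near=> h; rewrite /= -mulrDr addrA subrK.
by apply: DeriveDef; [apply/cvg_ex; exists (d + c * g x)|exact: cvg_lim quotient].
Unshelve. all: by end_near. Qed.

Lemma class_C_continuous k f : class_C k f -> continuous f.
Proof. by case: k => [|k] []. Qed.

Lemma is_derive_class_C f x v : class_C 1 f ->
  is_derive x v f (\sum_i v 0 i * partial i f x).
Proof.
move=> [cf df]; rewrite {1}(row_sum_delta v).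
elim: (index_enum _) => [|i r IH]; first by rewrite !big_nil; exact: is_derive0.
rewrite !big_cons [X in is_derive _ X]addrC [X in is_derive _ _ _ X]addrC.
apply: is_derive_dirD => // [y|]; first by apply: derivableP; exact: (df i).1.
by have [_ [c _]] := df i; exact: c.
Qed.

Lemma class_C_partial k f i : class_C k.+1 f -> class_C k (partial i f).
Proof. by case=> _ /(_ i)[]. Qed.

Lemma is_derive_partial k f i x : class_C k.+1 f ->
  is_derive x (delta_mx 0 i) f (partial i f x).
Proof. by case=> _ /(_ i)[df _]; exact: derivableP. Qed.

Lemma class_C_intro k f : continuous f ->
  (forall i, exists2 g, class_C k g & forall x, is_derive x (delta_mx 0 i) f (g x)) ->
  class_C k.+1 f.
Proof.
move=> cf df; split=> // i; have [g Cg dg] := df i; split=> [x|].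
  exact: (ex_derive (is_derive := dg x)).
by rewrite (_ : partial i f = g) //; apply/funext => x; exact: (derive_val (is_derive := dg x)).
Qed.

Lemma is_derive_lincomb (m : nat) (c d : 'I_m -> R) (F : 'I_m -> 'rV[R]_n -> R) x v :
  (forall j, is_derive x v (F j) (d j)) ->
  is_derive x v (fun y => \sum_j c j * F j y) (\sum_j c j * d j).
Proof.
move=> dF; have -> : (fun y => \sum_j c j * F j y) = \sum_j (c j \*: F j).
  by apply/funext => y; rewrite fct_sumE.
by apply: is_derive_sum => j; exact: is_deriveZ.
Qed.

Lemma continuous_lincomb (m : nat) (c : 'I_m -> R) (F : 'I_m -> 'rV[R]_n -> R) :
  (forall j, continuous (F j)) -> continuous (fun x => \sum_j c j * F j x).
Proof.
move=> cF; apply: continuous_big => [x|j _ x]; first exact: add_continuous.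
exact: cvgMl_tmp (cF j x).
Qed.

Lemma class_C_lincomb k (m : nat) (c : 'I_m -> R) (F : 'I_m -> 'rV[R]_n -> R) :
  (forall j, class_C k (F j)) -> class_C k (fun x => \sum_j c j * F j x).
Proof.
have cF k' (G : 'I_m -> 'rV[R]_n -> R) : (forall j, class_C k' (G j)) ->
    continuous (fun x => \sum_j c j * G j x).
  by move=> CG; apply: continuous_lincomb => j; exact: class_C_continuous (CG j).
elim: k F => [|k IH] F CF; first by split=> //; exact: cF CF.
apply: class_C_intro => [|i]; first exact: cF CF.
exists (fun x => \sum_j c j * partial i (F j) x).
  by apply: IH => j; exact: class_C_partial.
by move=> x; apply: is_derive_lincomb => j; exact: is_derive_partial.
Qed.

End DirectionalDerivative.

Section AffinePullback.
Context {R : realType} {m n : nat}.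
Variables (A : 'M[R]_(m, n)) (b : 'rV[R]_n).
Implicit Types f : 'rV[R]_n -> R.

Local Notation aff := (fun x : 'rV[R]_m => x *m A + b).

Lemma continuous_affine : continuous aff.
Proof.
have cA : continuous (fun x : 'rV[R]_m => x *m A).
  have -> : (fun x => x *m A) = fun x : 'rV[R]_m => \sum_i x 0 i *: row i A.
    by apply/funext => x; exact: mulmx_sum_row.
  apply: continuous_big => [x|i _ x]; first exact: add_continuous.
  exact: cvgZr_tmp (@coord_continuous R 1 m 0 i x).
by move=> x; exact: cvgD (cA x) (cvg_cst b).
Qed.

Lemma is_derive_affine f x v d :
  is_derive (aff x) (v *m A) f d -> is_derive x v (f \o aff) d.
Proof.
move=> /is_derive_line0 df; apply/is_derive_line0.
rewrite (_ : (fun h => _) = fun h => f (aff x + h *: (v *m A))) //.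
by apply/funext => h /=; rewrite mulmxDl -scalemxAl addrAC.
Qed.

Lemma is_derive_partial_affine k f i x : class_C k.+1 f ->
  is_derive x (delta_mx 0 i) (f \o aff) (\sum_j A i j * partial j f (aff x)).
Proof.
move=> Cf; apply: is_derive_affine; rewrite -rowE.
have Cf1 : class_C 1 f.
  case: Cf => cf df; split=> // j; have [dfj Cj] := df j.
  by split=> //; split=> //; exact: class_C_continuous Cj.
have := is_derive_class_C (aff x) (row i A) Cf1.
by under eq_bigr do rewrite mxE.
Qed.

Lemma class_C_affine k f : class_C k f -> class_C k (f \o aff).
Proof.
have cf_aff k' g : class_C k' g -> continuous (g \o aff).
  move=> Cg x; apply: continuous_comp; first exact: continuous_affine.
  exact: class_C_continuous Cg _.
elim: k f => [|k IH] f Cf; first by split=> //; exact: cf_aff Cf.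
apply: class_C_intro => [|i]; first exact: cf_aff Cf.
exists (fun x => \sum_j A i j * (partial j f \o aff) x).
  by apply: class_C_lincomb => j; apply: IH; exact: class_C_partial.
by move=> x; exact: is_derive_partial_affine Cf.
Qed.

Lemma partial_affine k f i : class_C k.+1 f ->
  partial i (f \o aff) = fun x => \sum_j A i j * (partial j f \o aff) x.
Proof.
move=> Cf; apply/funext => x.
exact: (derive_val (is_derive := is_derive_partial_affine i x Cf)).
Qed.

Lemma sum_conformal (c : R) (H : 'I_n -> 'I_n -> R) : A^T *m A = c%:M ->
  \sum_i \sum_j \sum_k A i j * A i k * H j k = c * \sum_j H j j.
Proof.
move=> AA.
have column_dot j k : \sum_i A i j * A i k = c * (j == k)%:R.
  move/matrixP/(_ j k) : AA; rewrite !mxE mulr_natr => <-.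
  by apply: eq_bigr => i _; rewrite mxE.
rewrite exchange_big mulr_sumr; apply: eq_bigr => j _ /=.
rewrite exchange_big /= (bigD1 j) //= -mulr_suml column_dot eqxx mulr1.
rewrite big1 ?addr0 // => k kj.
by rewrite -mulr_suml column_dot eq_sym (negbTE kj) mulr0 mul0r.
Qed.

Lemma laplacian_affine (c : R) f x : A^T *m A = c%:M -> class_C 2 f ->
  laplacian (f \o aff) x = c * laplacian f (aff x).
Proof.
move=> AA Cf; rewrite -(sum_conformal (fun j k => partial k (partial j f) (aff x)) AA).
apply: eq_bigr => i _; rewrite (partial_affine i Cf).
rewrite [LHS](derive_val (is_derive := is_derive_lincomb (A i)
  (fun j => is_derive_partial_affine i x (class_C_partial j Cf)))).
by apply: eq_bigr => j _; rewrite mulr_sumr; apply: eq_bigr => k _; rewrite mulrA.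
Qed.

End AffinePullback.

(** * A lower bound for the eigenvalues *)

Lemma is_derive_local_max (R : realType) (u u1 : R -> R) (c : R) :
  (forall t : R, is_derive t 1 u (u1 t)) -> (\forall t \near c, u t <= u c) -> u1 c = 0.
Proof.
move=> du /nbhs_ballP[e /= e0 umax].
have dc : is_derive c 1 u 0.
  apply: (@derive1_at_max R u (c - e) (c + e)) => [|t _||t].
  - by lra.
  - exact: (ex_derive (is_derive := du t)).
  - by rewrite in_itv /=; apply/andP; split; lra.
  by rewrite in_itv /= => ?; apply: umax; rewrite /ball /= distrC ltr_norml; lra.
by rewrite -(derive_val (is_derive := du c)); exact: (derive_val (is_derive := dc)).
Qed.

Lemma derive_gt0_right (R : realType) (u : R -> R) (c d : R) :
  is_derive c 1 u d -> 0 < d -> u c = 0 ->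
  exists2 r : R, 0 < r & forall h, 0 < h -> h < r -> 0 < u (c + h).
Proof.
move=> du d0 uc.
have quotient : h^-1 *: (u (h *: 1 + c) - u c) @[h --> 0^'] --> d by case: du => ? <-.
have /cvgrPdist_lt/(_ _ d0)/nbhs_ballP[r /= r0 near_d] := quotient.
exists r => // h h0 hr; have : `|d - h^-1 * u (c + h)| < d.
  have := near_d h; rewrite /ball /= sub0r normrN gtr0_norm // gt_eqF // => /(_ hr isT).
  by rewrite uc subr0 [h *: 1]mulr1 (addrC h).
rewrite -(pmulr_rgt0 _ (_ : 0 < h^-1)) ?invr_gt0 // ltr_norml => /andP[_].
by move: (h^-1 * _) => q; lra.
Qed.

Lemma second_derivative_max (R : realType) (u u1 : R -> R) (c d : R) :
  (forall t : R, is_derive t 1 u (u1 t)) -> is_derive c 1 u1 d ->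
  (\forall t \near c, u t <= u c) -> d <= 0.
Proof.
move=> du du1 umax; rewrite leNgt; apply/negP => d0.
have [r r0 u1_gt0] := derive_gt0_right du1 d0 (is_derive_local_max du umax).
have /nbhs_ballP[e /= e0 near_c] := umax.
pose m := Num.min e r; have m0 : 0 < m by rewrite lt_min e0.
pose h := m / 2; have h0 : 0 < h by rewrite divr_gt0.
have [he hr] : h < e /\ h < r by apply/andP; rewrite -lt_min -/m /h; lra.
have cu : {within `[c, c + h], continuous u}.
  by apply: continuous_subspaceT; exact: is_derive_continuous du.
have [|s] := @MVT R u u1 c (c + h) _ (fun t _ => du t) cu; first by lra.
rewrite in_itv /= => /andP[cs sch] increment.
have u1s : 0 < u1 s by rewrite -[s](subrKC c); apply: u1_gt0; lra.
have : 0 < u (c + h) - u c by rewrite increment mulr_gt0 //; lra.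
have : u (c + h) <= u c by apply: near_c; rewrite /ball /= opprD addNKr normrN gtr0_norm.
by lra.
Qed.

Section Helmholtz.
Context {R : realType} {n : nat}.
Implicit Types (f g : 'rV[R]_n -> R) (l : R).

Definition helmholtz l f : Prop := smooth f /\ forall x, - laplacian f x = l * f x.

Lemma smoothB f g : smooth f -> smooth g -> smooth (fun x => f x - g x).
Proof.
move=> sf sg k; pose F (j : 'I_2) := if j == 0 then f else g.
rewrite (_ : (fun x => _) = fun x => \sum_(j < 2) (-1) ^+ j * F j x); last first.
  apply/funext => x; rewrite !big_ord_recl big_ord0 /F /=.
  by rewrite expr0 expr1 mul1r mulN1r addr0.
by apply: class_C_lincomb => j; rewrite /F; case: ifP.
Qed.

Lemma smooth_partial f i : smooth f -> smooth (partial i f).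
Proof. by move=> sf k; exact: class_C_partial (sf k.+1). Qed.

Lemma smooth_derivable f i x : smooth f -> is_derive x (delta_mx 0 i) f (partial i f x).
Proof. by move=> sf; exact: is_derive_partial (sf 1%N). Qed.

Lemma partialB f g i : smooth f -> smooth g ->
  partial i (fun x => f x - g x) = fun x => partial i f x - partial i g x.
Proof.
move=> sf sg; apply/funext => x.
have [[df _] [dg _]] := (smooth_derivable i x sf, smooth_derivable i x sg).
by rewrite /partial -[fun y => _]/(f - g) deriveB.
Qed.

Lemma laplacianB f g x : smooth f -> smooth g ->
  laplacian (fun y => f y - g y) x = laplacian f x - laplacian g x.
Proof.
move=> sf sg; rewrite /laplacian -sumrB; apply: eq_bigr => i _.
by rewrite !partialB //; exact: smooth_partial.
Qed.

Lemma helmholtzB l f g : helmholtz l f -> helmholtz l g -> helmholtz l (fun x => f x - g x).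
Proof.
move=> [sf lf] [sg lg]; split=> [|x]; first exact: smoothB.
by rewrite laplacianB // opprB addrC mulrBr -lf -lg opprK.
Qed.

End Helmholtz.

Lemma helmholtz_affine (R : realType) (m n : nat) (A : 'M[R]_(m, n)) (b : 'rV[R]_n) (c l : R)
    (f : 'rV[R]_n -> R) :
  A^T *m A = c%:M -> helmholtz l f -> helmholtz (c * l) (fun x => f (x *m A + b)).
Proof.
move=> AA [sf lf]; split=> [k|x]; first exact: class_C_affine (sf k).
by rewrite (laplacian_affine b x AA (sf 2%N)) -mulrN lf mulrA.
Qed.

Definition int_periodic {R : realType} {n : nat} (f : 'rV[R]_n -> R) : Prop :=
  forall (z : 'rV[int]_n) x, f (x + intmx z) = f x.

Section Slab.
Context {R : realType} {n : nat}.
Variables (I : {set 'I_n}) (c : 'rV[R]_n) (r theta : R).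
Hypotheses (theta_gt0 : 0 < theta) (theta_r : theta * r < pi / 2).
Implicit Types (x : 'rV[R]_n) (f : 'rV[R]_n -> R).

Definition slab : set 'rV[R]_n := [set x | forall i, i \in I -> `|x 0 i - c 0 i| <= r].

Definition barrier x : R := \prod_(i in I) cos (theta * (x 0 i - c 0 i)).

Lemma barrier_gt0 x : slab x -> 0 < barrier x.
Proof.
move=> xS; apply: prodr_gt0 => i iI; apply: cos_gt0_pihalf.
rewrite -ltr_norml normrM gtr0_norm //; apply: le_lt_trans theta_r.
by rewrite ler_pM2l // xS.
Qed.

Lemma continuous_barrier : continuous barrier.
Proof.
apply: continuous_big => [x|i _ x]; first exact: mul_continuous.
apply: continuous_comp; last exact: continuous_cos.
have cx := @coord_continuous R 1 n 0 i x.
exact: cvgMl_tmp (cvgB cx (cvg_cst (c 0 i))).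
Qed.

Lemma barrier_second_derivative x k :
  exists2 b1 : R -> R,
    forall t : R, is_derive t 1 (fun h : R => barrier (x + h *: delta_mx 0 k)) (b1 t) &
    is_derive (0 : R) 1 b1 (- ((k \in I)%:R * theta ^+ 2 * barrier x)).
Proof.
have coord h i : (x + h *: delta_mx 0 k) 0 i = x 0 i + h * (i == k)%:R by rewrite !mxE eqxx.
have [kI|kI] := boolP (k \in I); last first.
  rewrite !mul0r oppr0; exists (cst 0) => [t|]; last exact: is_derive_cst.
  rewrite (_ : (fun h => _) = cst (barrier x)); first exact: is_derive_cst.
  apply/funext => h; apply: eq_bigr => i iI; rewrite coord.
  by rewrite (_ : i == k = false) ?mulr0 ?addr0 //; apply: contraNF kI => /eqP <-.
pose C := \prod_(i in I | i != k) cos (theta * (x 0 i - c 0 i)).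
pose a := theta * (x 0 k - c 0 k).
have lineE h : barrier (x + h *: delta_mx 0 k) = C * cos (a + theta * h).
  rewrite /barrier (bigD1 k) //= coord eqxx mulr1 mulrC.
  congr (_ * cos _); last by rewrite /a; ring.
  by apply: eq_bigr => i /andP[_ /negbTE ik]; rewrite coord ik mulr0 addr0.
exists (fun h => - (C * theta * sin (a + theta * h))) => [t|].
  by rewrite (funext lineE); apply: is_derive_eq; rewrite /GRing.scale /=; ring.
have := lineE 0; rewrite scale0r addr0 => ->.
by apply: is_derive_eq; rewrite /GRing.scale /=; ring.
Qed.

Section Maximum.
Variable f : 'rV[R]_n -> R.
Hypothesis continuous_f : continuous f.
Hypothesis periodic_f : int_periodic f.
Hypothesis boundary_f : forall x i, i \in I -> `|x 0 i - c 0 i| = r -> f x = 0.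

Definition cell_side i : interval R := if i \in I then `[c 0 i - r, c 0 i + r] else `[0, 1].

Definition slab_cell : set 'rV[R]_n := [set x | forall i, x 0 i \in cell_side i].

Lemma compact_slab_cell : compact slab_cell.
Proof.
apply: (@rV_compact _ _ (fun i => [set` cell_side i])) => i.
by rewrite /cell_side; case: ifP => _; exact: segment_compact.
Qed.

Lemma slab_cell_slab x : slab_cell x -> slab x.
Proof.
move=> xK i iI; have := xK i; rewrite /cell_side iI in_itv /= => /andP[]; rewrite ler_norml; lra.
Qed.

Lemma slab_cell_translate x : slab x ->
  exists2 z : 'rV[int]_n, slab_cell (x - intmx z) & barrier (x - intmx z) = barrier x.
Proof.
move=> xS; exists (\row_i if i \in I then 0 else Num.floor (x 0 i)) => [i|].
  rewrite /cell_side !mxE; case: ifP => iI; rewrite in_itv /=.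
    by have := xS i iI; rewrite subr0 ler_norml => /andP[]; lra.
  rewrite subr_ge0 floor_le_tmp /= lerBlDr.
  by have := floorD1_gt (x 0 i); rewrite intrD addrC => /ltW.
by apply: eq_bigr => i iI; rewrite !mxE iI subr0.
Qed.

Lemma continuous_ratio x : slab x -> {for x, continuous (fun y => `|f y| / barrier y)}.
Proof.
move=> xS; have cvg_f : `|f y| @[y --> x] --> `|f x| by exact: cvg_norm (@continuous_f x).
have cvg_b : (barrier y)^-1 @[y --> x] --> (barrier x)^-1.
  exact: cvgV (lt0r_neq0 (barrier_gt0 xS)) (@continuous_barrier x).
exact: cvgM cvg_f cvg_b.
Qed.

Lemma slab_maximum x0 : slab x0 -> f x0 != 0 -> exists2 x, slab x &
  exists M, [/\ 0 < M, `|f x| = M * barrier x & forall y, slab y -> `|f y| <= M * barrier y].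
Proof.
move=> x0S fx0; have translate y : slab y -> exists2 z, slab_cell z &
    f z = f y /\ barrier z = barrier y.
  move=> /slab_cell_translate[z zK zb]; exists (y - intmx z) => //; split=> //.
  by rewrite -(periodic_f z) subrK.
pose ratio x := `|f x| / barrier x.
have [||x xK xmax] := @EVT_max_rV R n ratio slab_cell _ compact_slab_cell.
- by have [z zK _] := translate x0 x0S; exists z.
- apply: continuous_in_subspaceT => x; rewrite inE => xK.
  exact: continuous_ratio (slab_cell_slab xK).
move: xK; rewrite inE => xK; have xS := slab_cell_slab xK.
have ratio_max y : slab y -> `|f y| <= ratio x * barrier y.
  move=> yS; have [z zK [<- <-]] := translate y yS; rewrite -ler_pdivrMr.
    by apply: xmax; rewrite inE.
  exact: barrier_gt0 (slab_cell_slab zK).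
exists x => //; exists (ratio x); split=> //; last by rewrite divfK // gt_eqF ?barrier_gt0.
rewrite -(pmulr_lgt0 _ (barrier_gt0 x0S)); apply: lt_le_trans (ratio_max x0 x0S).
by rewrite normr_gt0.
Qed.

Lemma near_slab x k : slab x -> f x != 0 -> \forall h \near (0 : R), slab (x + h *: delta_mx 0 k).
Proof.
move=> xS fx.
have coord h i : (x + h *: delta_mx 0 k) 0 i = x 0 i + h * (i == k)%:R by rewrite !mxE eqxx.
have [kI|kI] := boolP (k \in I); last first.
  near=> h => i iI; rewrite coord (_ : i == k = false) ?mulr0 ?addr0; first exact: xS.
  by apply: contraNF kI => /eqP <-.
have gap : 0 < r - `|x 0 k - c 0 k|.
  rewrite subr_gt0 lt_def xS // andbT; apply: contraNneq fx => xr.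
  by apply/eqP/(@boundary_f x k).
near=> h => i iI; rewrite coord; have [->|ik] := eqVneq i k; last by rewrite mulr0 addr0 xS.
rewrite mulr1 addrAC; apply: le_trans (ler_normD _ _) _; rewrite -lerBrDl.
by near: h; exact: (@nbhs0_le R R _ gap).
Unshelve. all: by end_near. Qed.

End Maximum.

Lemma touching_second_derivative f x k (s M : R) : smooth f ->
  s * f x = M * barrier x ->
  (\forall h \near (0 : R),
    s * f (x + h *: delta_mx 0 k) <= M * barrier (x + h *: delta_mx 0 k)) ->
  s * partial k (partial k f) x <= - ((k \in I)%:R * theta ^+ 2 * (s * f x)).
Proof.
move=> sf touch below; have [b1 db db1] := barrier_second_derivative x k.
pose u h := s * f (x + h *: delta_mx 0 k) - M * barrier (x + h *: delta_mx 0 k).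
pose u1 h := s * partial k f (x + h *: delta_mx 0 k) - M * b1 h.
have df g (t : R) : smooth g ->
    is_derive t 1 (fun h : R => g (x + h *: delta_mx 0 k))
      (partial k g (x + t *: delta_mx 0 k)).
  by move=> sg; apply/is_derive_line; exact: smooth_derivable.
have du (t : R) : is_derive t 1 u (u1 t).
  exact: is_deriveB (is_deriveZ s (df f t sf)) (is_deriveZ M (db t)).
have du1 := is_deriveB (is_deriveZ s (df _ 0 (smooth_partial k sf))) (is_deriveZ M db1).
have umax : \forall t \near (0 : R), u t <= u 0.
  by near=> t; rewrite /u scale0r addr0 touch subrr subr_le0; near: t.
have := second_derivative_max du du1 umax.
by rewrite scale0r addr0 touch /GRing.scale /=; lra.
Unshelve. all: by end_near. Qed.

(* Barta's argument: where [`|f| / barrier] is maximal, the second derivatives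
   of [`|f|] are at most those of a multiple of the barrier touching it there. *)
Lemma barrier_le_eigenvalue (l : R) f : helmholtz l f -> int_periodic f ->
  (forall x i, i \in I -> `|x 0 i - c 0 i| = r -> f x = 0) ->
  (exists2 x, slab x & f x != 0) -> #|I|%:R * theta ^+ 2 <= l.
Proof.
move=> [sf lf] pf bf [x0 x0S fx0].
have [x xS [M [M0 fxM Mmax]]] := slab_maximum (class_C_continuous (sf 0%N)) pf x0S fx0.
have fx_gt0 : 0 < `|f x| by rewrite fxM mulr_gt0 // barrier_gt0.
have fx : f x != 0 by rewrite -normr_gt0.
pose s := Num.sg (f x).
have sfx : s * f x = `|f x| by rewrite normrEsg.
have second k : s * partial k (partial k f) x <= - ((k \in I)%:R * theta ^+ 2 * `|f x|).
  rewrite -sfx; apply: (@touching_second_derivative f x k s M) => //; first by rewrite sfx.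
  near=> h; have /Mmax : slab (x + h *: delta_mx 0 k).
    by near: h; exact: (near_slab bf k xS fx).
  by apply: le_trans; rewrite (le_trans (ler_norm _)) // normrM normr_sg fx mul1r.
have : s * laplacian f x <= - (#|I|%:R * theta ^+ 2 * `|f x|).
  rewrite /laplacian mulr_sumr; apply: le_trans (ler_sum _ (fun k _ => second k)) _.
  rewrite sumrN -!mulr_suml (_ : \sum_k _ = #|I|%:R) // -sumr_const [RHS]big_mkcond.
  by apply: eq_bigr => k _; case: (k \in I).
by rewrite -[laplacian f x]opprK lf mulrN lerN2 (mulrCA s) sfx ler_pM2r.
Unshelve. all: by end_near. Qed.

End Slab.

Theorem slab_eigenvalue_ge (R : realType) (n : nat) (I : {set 'I_n}) (a : 'rV[R]_n) (w l : R)
    (f : 'rV[R]_n -> R) : 0 < w -> helmholtz l f -> int_periodic f ->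
  (forall (x : 'rV[R]_n) i (k : int), i \in I -> x 0 i = a 0 i + k%:~R * w -> f x = 0) ->
  (exists x, f x != 0) -> #|I|%:R * (pi / w) ^+ 2 <= l.
Proof.
move=> w0 lf pf zf [x0 fx0].
pose k i := Num.floor ((x0 0 i - a 0 i) / w).
pose c : 'rV[R]_n := \row_i (a 0 i + ((k i)%:~R + 2^-1) * w).
have x0S : slab I c (w / 2) x0.
  move=> i _; rewrite mxE ler_norml.
  have := floor_le_tmp ((x0 0 i - a 0 i) / w); have := floorD1_gt ((x0 0 i - a 0 i) / w).
  rewrite intrD -/(k i) ltr_pdivrMr // ler_pdivlMr //; lra.
have theta_le t : 0 < t -> t < pi / w -> #|I|%:R * t ^+ 2 <= l.
  move=> t0 tw; apply: (@barrier_le_eigenvalue R n I c (w / 2) t t0 _ l f lf pf) => //.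
  - by rewrite mulrA ltr_pM2r // -ltr_pdivlMr.
  - move=> x i iI; rewrite mxE; case: (ger0P (x 0 i - _)) => _ E.
      by apply: (zf x i (k i + 1) iI); rewrite intrD; lra.
    by apply: (zf x i (k i) iI); lra.
  - by exists x0.
have pw0 : 0 < pi / w by rewrite divr_gt0 // pi_gt0.
have l0 : 0 <= l.
  by apply: le_trans (theta_le (pi / w / 2) _ _); [rewrite mulr_ge0 ?sqr_ge0|lra|lra].
have [I0|I0] := posnP #|I|; first by rewrite I0 mul0r.
have {}I0 : 0 < #|I|%:R :> R by rewrite ltr0n.
rewrite mulrC -ler_pdivlMr // -ler_sqrt ?divr_ge0 // ?(ltW I0) // sqrtr_sqr gtr0_norm //.
apply/ler_addgt0Pr => e e0; rewrite -lerBlDr.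
have [t0|t0] := lerP (pi / w - e) 0; first by rewrite (le_trans t0) ?sqrtr_ge0.
rewrite -[leLHS]gtr0_norm // -sqrtr_sqr ler_wsqrtr // ler_pdivlMr // mulrC theta_le //.
by rewrite ltrBlDr ltrDl.
Qed.

Lemma periodicz (U V : zmodType) (f : U -> V) (v : U) :
  trigo.periodic f v -> forall (m : int) u, f (u + v *~ m) = f u.
Proof.
move=> fv [m|m] u; first exact: periodicn.
by rewrite NegzE mulrNz -(periodicn fv m.+1 (u - _)) subrK.
Qed.

Section Reflection.
Context {R : realType} {n : nat}.
Implicit Types (i j k : 'I_n) (a b l : R) (f : 'rV[R]_n -> R) (x : 'rV[R]_n).

Definition reflection i a x : 'rV[R]_n := x - (2 * (x 0 i - a)) *: delta_mx 0 i.

Lemma reflectionE i a x k : reflection i a x 0 k = if k == i then 2 * a - x 0 i else x 0 k.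
Proof. by rewrite !mxE eqxx /=; have [->|_] := eqVneq k i; rewrite /=; ring. Qed.

Lemma reflectionK i a : involutive (reflection i a).
Proof. by move=> x; apply/rowP => k; rewrite !reflectionE eqxx; case: eqVneq => // ->; ring. Qed.

Lemma reflectionC i j a b x : i != j ->
  reflection i a (reflection j b x) = reflection j b (reflection i a x).
Proof.
move=> ij; apply/rowP => k; rewrite !reflectionE [j == i]eq_sym (negbTE ij).
by have [->|_] := eqVneq k i; rewrite ?(negbTE ij).
Qed.

Lemma reflectionD i a x v :
  reflection i a (x + v) = reflection i a x + (v - (2 * v 0 i) *: delta_mx 0 i).
Proof. by apply/rowP => k; rewrite !mxE eqxx; ring. Qed.

Lemma reflection_affine i a x : reflection i a x =
  x *m (1%:M - 2 *: delta_mx i i) + (2 * a) *: delta_mx 0 i.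
Proof.
rewrite mulmxBr mulmx1 -scalemxAr; apply/rowP => k; rewrite !mxE (bigD1 i) //= big1.
  by rewrite !mxE !eqxx; ring.
by move=> j ji; rewrite mxE (negbTE ji) mulr0.
Qed.

Lemma helmholtz_reflection i a l f : helmholtz l f -> helmholtz l (f \o reflection i a).
Proof.
move=> lf; pose A : 'M[R]_n := 1%:M - 2 *: delta_mx i i.
have AT : A^T = A by apply/matrixP => j k; rewrite !mxE eq_sym andbC.
have AA : A^T *m A = 1%:M.
  rewrite AT mulmxBl mul1mx -scalemxAl mulmxBr mulmx1 -scalemxAr mul_delta_mx.
  by rewrite [2 *: delta_mx i i]scaler_nat mulr2n opprD addrA subrr sub0r scalerN opprK subrK.
have := helmholtz_affine ((2 * a) *: delta_mx 0 i) AA lf; rewrite mul1r.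
rewrite (_ : (fun x => _) = f \o reflection i a) //.
by apply/funext => x /=; rewrite reflection_affine.
Qed.

Definition odd_about i a f : Prop := forall x, f (reflection i a x) = - f x.

Definition odd_part i a f x : R := f x - f (reflection i a x).

Lemma odd_about_odd_part i a f : odd_about i a (odd_part i a f).
Proof. by move=> x; rewrite /odd_part reflectionK opprB. Qed.

Lemma odd_about_odd_partC i j a b f : i != j ->
  odd_about i a f -> odd_about i a (odd_part j b f).
Proof. by move=> ij odd_f x; rewrite /odd_part -reflectionC // !odd_f; ring. Qed.

Lemma helmholtz_odd_part i a l f : helmholtz l f -> helmholtz l (odd_part i a f).
Proof. by move=> lf; apply: helmholtzB => //; exact: helmholtz_reflection. Qed.

Definition constant_along i f : Prop := forall x s, f (x + s *: delta_mx 0 i) = f x.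

Lemma odd_part_neq0 i f : ~ constant_along i f -> exists a x, odd_part i a f x != 0.
Proof.
move=> /existsNP[x /existsNP[s /eqP fs]]; exists (x 0 i + s / 2), x.
rewrite /odd_part subr_eq0 eq_sym (_ : reflection _ _ _ = x + s *: delta_mx 0 i) //.
by rewrite /reflection -scaleNr; congr (_ + _ *: _); field.
Qed.

Lemma partial_constant_along i f : constant_along i f -> partial i f = cst 0.
Proof.
move=> fi; apply/funext => x; rewrite /partial.
have df : is_derive x (delta_mx 0 i) f 0.
  apply/is_derive_line0; rewrite (_ : (fun h => _) = cst (f x)); first exact: is_derive_cst.
  by apply/funext => h; exact: fi.
exact: (derive_val (is_derive := df)).
Qed.

Lemma laplacian_constant f x : (forall i, constant_along i f) -> laplacian f x = 0.
Proof.
move=> fcst; apply: big1 => i _; rewrite (partial_constant_along (fcst i)).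
by rewrite partial_constant_along.
Qed.

Lemma constant_along_sum (P : pred 'I_n) f (v : 'rV[R]_n) x :
  (forall k, P k -> constant_along k f) -> (forall k, ~~ P k -> v 0 k = 0) -> f (x + v) = f x.
Proof.
move=> fP vP; rewrite [v]row_sum_delta; elim: (index_enum _) x => [|k r IH] x.
  by rewrite big_nil addr0.
rewrite big_cons addrA IH; have [/fP|/vP ->] := boolP (P k); first exact.
by rewrite scale0r addr0.
Qed.

Lemma odd_about_eq0 i a w f x (k : int) : odd_about i a f ->
  trigo.periodic f ((2 * w) *: delta_mx 0 i) -> x 0 i = a + k%:~R * w -> f x = 0.
Proof.
move=> odd_f pf xi.
have : f (reflection i a x) = f x.
  rewrite -(periodicz pf k); congr f; apply/rowP => j; rewrite mxE -scaler_int !mxE eqxx xi.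
  by have [->|_] := eqVneq j i; rewrite /= ?xi; ring.
by rewrite odd_f; lra.
Qed.

End Reflection.

Definition half_integral_periodic {R : realType} {n : nat} (f : 'rV[R]_n -> R) : Prop :=
  int_periodic f /\ trigo.periodic f (const_mx 2^-1).

Lemma half_integral_odd_part (R : realType) (n : nat) (f : 'rV[R]_n -> R) i a :
  half_integral_periodic f -> half_integral_periodic (odd_part i a f).
Proof.
move=> [fz fh].
have fzN (z : 'rV[int]_n) x : f (x - intmx z) = f x by rewrite -(fz z) subrK.
have dz (k : int) : k%:~R *: delta_mx 0 i = intmx (k *: delta_mx 0 i) :> 'rV[R]_n.
  by rewrite (map_mxZ intr) (map_delta_mx intr).
split=> [z x|x]; rewrite /odd_part ?fz ?fh reflectionD; congr (_ - _).
  by rewrite mxE -[2]/(2%:~R) -intrM dz addrA fzN fz.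
by rewrite mxE divff // -[1]/(1%:~R) dz addrA fzN fh.
Qed.

Lemma eigenvalue_ge_two_directions (R : realType) (n : nat) (f : 'rV[R]_n -> R) (l a b : R)
    (i j : 'I_n) : helmholtz l f -> int_periodic f -> (exists x, f x != 0) ->
  i != j -> odd_about i a f -> odd_about j b f -> 8 * pi ^+ 2 <= l.
Proof.
move=> lf pf f0 ij odd_i odd_j.
have unit_period k : trigo.periodic f ((2 * 2^-1) *: delta_mx 0 k).
  by move=> x; rewrite divff // scale1r -(map_delta_mx intr) pf.
have : #|[set i; j]%SET|%:R * (pi / 2^-1) ^+ 2 <= l.
  apply: (slab_eigenvalue_ge (a := \row_k if k == i then a else b) _ lf pf) => // x k m.
  rewrite !inE mxE => /orP[]/eqP ->; rewrite ?eqxx 1?eq_sym ?(negbTE ij).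
    exact: odd_about_eq0 odd_i (unit_period i).
  exact: odd_about_eq0 odd_j (unit_period j).
by rewrite cards2 ij invrK /=; lra.
Qed.

Lemma eigenvalue_ge_one_direction (R : realType) (n : nat) (f : 'rV[R]_n -> R) (l a : R)
    (i : 'I_n) : helmholtz l f -> half_integral_periodic f -> (exists x, f x != 0) ->
  odd_about i a f -> (forall j, j != i -> constant_along j f) -> 16 * pi ^+ 2 <= l.
Proof.
move=> lf [pf hf] f0 odd_i fcst.
have half_period : trigo.periodic f ((2 * 4^-1) *: delta_mx 0 i).
  have -> : 2 * 4^-1 = 2^-1 :> R by field.
  move=> x; pose v : 'rV[R]_n := const_mx 2^-1 - 2^-1 *: delta_mx 0 i.
  have fv y : f (y + v) = f y.
    apply: (constant_along_sum (P := predC1 i)) => [k /fcst//|k /negPn/eqP ->].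
    by rewrite !mxE !eqxx mulr1 subrr.
  by rewrite -fv -addrA [_ *: _ + v]addrC subrK hf.
have : #|[set i]%SET|%:R * (pi / 4^-1) ^+ 2 <= l.
  apply: (slab_eigenvalue_ge (a := const_mx a) _ lf pf) => // x k m.
  by rewrite inE mxE => /eqP ->; exact: odd_about_eq0 odd_i half_period.
by rewrite cards1 invrK; lra.
Qed.

(* In a direction along which the eigenfunction is not constant it can be made
   odd about some centre; if only one such direction is left, invariance under
   the half sum halves the period. *)
Theorem half_integral_eigenvalue_ge (R : realType) (n : nat) (f : 'rV[R]_n -> R) (l : R) :
  helmholtz l f -> half_integral_periodic f -> (exists x, f x != 0) -> 0 < l ->
  8 * pi ^+ 2 <= l.
Proof.
move=> lf pf [x0 fx0] l0.
have [i fi] : exists i, ~ constant_along i f.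
  apply/existsNP => fcst.
  have [_ /(_ x0)] := lf; rewrite laplacian_constant // oppr0 => /esym/eqP.
  by rewrite mulf_eq0 (negbTE fx0) gt_eqF.
have [a g0] := odd_part_neq0 fi.
have lg := helmholtz_odd_part i a lf; have pg := half_integral_odd_part i a pf.
have odd_g := odd_about_odd_part i a f.
move: (odd_part i a f) g0 lg pg odd_g => g g0 lg pg odd_g.
have [gcst|/existsNP[j /not_implyP[ji gj]]] := pselect (forall j, j != i -> constant_along j g).
  have := eigenvalue_ge_one_direction lg pg g0 odd_g gcst.
  by have := sqr_ge0 (pi : R); lra.
have [b h0] := odd_part_neq0 gj.
apply: (eigenvalue_ge_two_directions (helmholtz_odd_part j b lg) _ h0 _ _
  (odd_about_odd_part j b g)); first exact: (half_integral_odd_part j b pg).1.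
  by rewrite eq_sym; exact: ji.
by apply: odd_about_odd_partC; rewrite // eq_sym.
Qed.

(** * Waves and immersions by waves *)

Lemma cosDint (R : realType) (t z : R) :
  z \is a Num.int -> cos (t + 2 * pi * z) = cos t.
Proof.
by move=> /intrP[m ->]; rewrite mulr_natl mulrzr (periodicz (@cosD2pi R)).
Qed.

Section Waves.
Context {R : realType} {n : nat}.
Implicit Types (a p : R) (xi x v : 'rV[R]_n) (L : set 'rV[R]_n).

Definition wave a xi p : 'rV[R]_n -> R := fun x => a * cos (dot xi x + p).

Lemma is_derive_wave a xi p x v :
  is_derive x v (wave a xi p) (wave (a * dot xi v) xi (p + pi / 2) x).
Proof.
apply/is_derive_line0.
have -> : (fun h => wave a xi p (x + h *: v)) =
    (fun h : R => a * cos (h * dot xi v + (dot xi x + p))).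
  by apply/funext => h; rewrite /wave dotDr dotZr addrCA addrA.
rewrite /wave addrA cosDpihalf; apply: is_derive_eq.
by rewrite /= !scaler0 ?mul0r ?add0r ?addr0 ?mulr1 /GRing.scale /=; ring.
Qed.

Lemma continuous_wave a xi p : continuous (wave a xi p).
Proof.
move=> x; have cdot : dot xi y @[y --> x] --> dot xi x.
  apply: (@continuous_lincomb R n n (fun i => xi 0 i) (fun i (y : 'rV[R]_n) => y 0 i)) => i y.
  exact: coord_continuous.
have carg : (fun y => dot xi y + p) y @[y --> x] --> dot xi x + p.
  exact: cvgD cdot (cvg_cst p).
have ccos : cos (dot xi y + p) @[y --> x] --> cos (dot xi x + p).
  by apply: (cvg_comp _ _ carg); exact: continuous_cos.
exact: cvgMl_tmp ccos.
Qed.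

Lemma partial_wave a xi p i :
  partial i (wave a xi p) = wave (a * xi 0 i) xi (p + pi / 2).
Proof.
apply/funext => x; rewrite /partial (derive_val (is_derive := is_derive_wave _ _ _ _ _)).
congr (wave (a * _) _ _ _); rewrite /dot (bigD1 i) //= !mxE !eqxx mulr1.
by rewrite big1 ?addr0 // => j ji; rewrite mxE (negbTE ji) andbF mulr0.
Qed.

Lemma smooth_wave a xi p : smooth (wave a xi p).
Proof.
move=> k; elim: k a p => [|k IH] a p /=; first by split=> //; exact: continuous_wave.
split=> [|i]; first exact: continuous_wave.
split=> [x|]; first exact: (ex_derive (is_derive := is_derive_wave _ _ _ _ _)).
by rewrite partial_wave.
Qed.

Lemma laplacian_wave a xi p x :
  - laplacian (wave a xi p) x = dot xi xi * wave a xi p x.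
Proof.
rewrite /laplacian /dot mulr_suml -sumrN; apply: eq_bigr => i _.
by rewrite !partial_wave /wave addrA cosDpihalf addrA sinDpihalf; ring.
Qed.

Lemma eigenfunction_wave L a p xi :
  a != 0 -> xi != 0 -> dual_lattice L xi ->
  eigenfunction L (4 * pi ^+ 2 * dot xi xi) (wave a ((2 * pi) *: xi) p).
Proof.
move=> a0 xi0 xiL; have pi_neq0 : pi != 0 :> R by rewrite gt_eqF ?pi_gt0.
split; first exact: smooth_wave.
- by move=> v Lv x; rewrite /wave dotDr !dotZl addrAC cosDint //; exact: xiL.
- exists ((- p / (2 * pi * dot xi xi)) *: xi).
  rewrite /wave dotZl dotZr (_ : _ + p = 0) ?cos0 ?mulr1 //.
  move: xi0 pi_neq0; rewrite -dot_eq0; move: (dot xi xi) (pi : R) => d w d0 w0.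
  by field; rewrite d0.
- by move=> x; rewrite laplacian_wave dotZl dotZr; congr (_ * _); ring.
Qed.

Lemma laplace_eigenvalue_dual L xi : dual_lattice L xi -> xi != 0 ->
  0 < 4 * pi ^+ 2 * dot xi xi /\ laplace_eigenvalue L (4 * pi ^+ 2 * dot xi xi).
Proof.
move=> xiL xi0; split.
  by rewrite !mulr_gt0 ?exprn_gt0 ?pi_gt0 // lt_def dot_eq0 xi0 dot_ge0.
by exists (wave 1 ((2 * pi) *: xi) 0); apply: eigenfunction_wave; rewrite ?oner_neq0.
Qed.

Lemma lambda1_le L xi :
  dual_lattice L xi -> xi != 0 -> lambda1 L <= 4 * pi ^+ 2 * dot xi xi.
Proof.
move=> xiL xi0; apply: ge_inf; last exact: laplace_eigenvalue_dual.
by exists 0 => l [/ltW].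
Qed.

Lemma le_lambda1 L m xi : dual_lattice L xi -> xi != 0 ->
  (forall l, 0 < l -> laplace_eigenvalue L l -> m <= l) -> m <= lambda1 L.
Proof.
move=> xiL xi0 mL; apply: lb_le_inf => [|l [l0 Ll]]; last exact: mL.
by exists (4 * pi ^+ 2 * dot xi xi); exact: laplace_eigenvalue_dual.
Qed.

Lemma lambda1_ge0 L : 0 <= lambda1 L.
Proof.
rewrite /lambda1; set E := [set l | _]; have [->|/set0P ne0] := eqVneq E set0.
  by rewrite inf0.
by apply: lb_le_inf => // l [/ltW].
Qed.

End Waves.

Section WaveImmersion.
Context {R : realType} {n : nat} {T : finType}.
Variables (L : set 'rV[R]_n) (xi : T -> 'rV[R]_n) (q : R) (t0 : T).
Hypothesis xi_dual : forall t, dual_lattice L (xi t).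
Hypothesis xi_neq0 : forall t, xi t != 0.
Hypothesis xi_norm : forall t, dot (xi t) (xi t) = q.
Hypothesis xi_lambda1 : lambda1 L = 4 * pi ^+ 2 * q.
Hypothesis xi_tight : forall i j,
  4 * pi ^+ 2 * \sum_t xi t 0 i * xi t 0 j = #|T|%:R * (i == j)%:R.

Local Notation a := (Num.sqrt (#|T|%:R : R))^-1.
Local Notation freq t := ((2 * pi) *: xi t).
Local Notation phase b := (if b then 0 else pi / 2 : R).

Definition wave_immersion (x : 'rV[R]_n) : 'rV[R]_(#|{: T * bool}|) :=
  \row_k wave a (freq (enum_val k).1) (phase (enum_val k).2) x.

Let u := wave_immersion.

Lemma sum_waves (F : T -> bool -> R) :
  \sum_(k < #|{: T * bool}|) F (enum_val k).1 (enum_val k).2 =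
  \sum_t (F t true + F t false).
Proof.
transitivity (\sum_(tb : T * bool) F tb.1 tb.2).
  by rewrite [RHS](reindex _ (onW_bij _ (enum_val_bij _))).
rewrite -(pair_bigA _ (fun t b => F t b)) /=.
by apply: eq_bigr => t _; rewrite big_bool.
Qed.

Lemma amplitude_neq0 : a != 0.
Proof.
by rewrite invr_eq0 sqrtr_eq0 -ltNge ltr0n; apply/card_gt0P; exists t0.
Qed.

Lemma amplitude_sqr_card : a ^+ 2 * #|T|%:R = 1.
Proof.
rewrite exprVn sqr_sqrtr ?ler0n // mulVf // pnatr_eq0 -lt0n.
by apply/card_gt0P; exists t0.
Qed.

Lemma coordinate_wave k : coordinate u k =
  wave a (freq (enum_val k).1) (phase (enum_val k).2).
Proof. by apply/funext => x; rewrite /coordinate mxE. Qed.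

Lemma partial_map_wave i x : partial_map i u x =
  \row_k wave (a * freq (enum_val k).1 0 i) (freq (enum_val k).1)
           (phase (enum_val k).2 + pi / 2) x.
Proof. by apply/rowP => k; rewrite !mxE coordinate_wave partial_wave mxE. Qed.

Lemma dot_wave_immersion x : dot (u x) (u x) = 1.
Proof.
rewrite -amplitude_sqr_card /dot.
under eq_bigr do rewrite !mxE.
rewrite (sum_waves (fun t b => wave a (freq t) (phase b) x * wave a (freq t) (phase b) x)).
rewrite (eq_bigr (fun=> a ^+ 2)) ?sumr_const ?mulr_natr //.
move=> t _; rewrite /wave addr0 cosDpihalf -[RHS]mulr1.
by rewrite -[X in _ = _ * X](cos2Dsin2 (dot (freq t) x)); ring.
Qed.

Lemma dot_wave_immersion_partial i x : dot (u x) (partial_map i u x) = 0.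
Proof.
rewrite partial_map_wave /dot; under eq_bigr do rewrite !mxE.
rewrite (sum_waves (fun t b => wave a (freq t) (phase b) x *
  wave (a * (2 * pi * xi t 0 i)) (freq t) (phase b + pi / 2) x)).
by apply: big1 => t _; rewrite /wave !addrA !addr0 !cosDpihalf sinDpihalf; ring.
Qed.

Lemma first_form_wave_immersion x : first_form u x = 1%:M.
Proof.
apply/matrixP => i j; rewrite !mxE !partial_map_wave /dot.
under eq_bigr do rewrite !mxE.
rewrite (sum_waves (fun t b => wave (a * (2 * pi * xi t 0 i)) (freq t) (phase b + pi / 2) x *
  wave (a * (2 * pi * xi t 0 j)) (freq t) (phase b + pi / 2) x)).
rewrite (eq_bigr (fun t => a ^+ 2 * (4 * pi ^+ 2 * (xi t 0 i * xi t 0 j)))); last first.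
  move=> t _; rewrite /wave !addrA !addr0 !cosDpihalf sinDpihalf.
  by rewrite -[RHS]mulr1 -[X in _ = _ * X](cos2Dsin2 (dot (freq t) x)); ring.
by rewrite -mulr_sumr -mulr_sumr xi_tight mulrA amplitude_sqr_card mul1r.
Qed.

Lemma laplacian_wave_immersion x : \sum_i partial_map i (partial_map i u) x =
  - (4 * pi ^+ 2 * q) *: u x.
Proof.
apply/rowP => k; rewrite summxE !mxE.
have := laplacian_wave a (freq (enum_val k).1) (phase (enum_val k).2) x.
rewrite dotZl dotZr xi_norm => /(congr1 -%R); rewrite opprK => lap.
transitivity (laplacian (wave a (freq (enum_val k).1) (phase (enum_val k).2)) x).
  apply: eq_bigr => i _; rewrite mxE; congr (partial _ _ _).
  by apply/funext => y; rewrite /coordinate mxE coordinate_wave.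
by rewrite lap -mulNr; congr (_ * _); ring.
Qed.

Lemma normal_part_wave_immersion x w : normal_part u x w =
  w - dot w (u x) *: u x - \sum_i dot w (partial_map i u x) *: partial_map i u x.
Proof.
rewrite /normal_part first_form_wave_immersion invmx1; congr (_ - _).
apply: eq_bigr => i _; rewrite (bigD1 i) //= mxE eqxx mul1r big1 ?addr0 // => j ji.
by rewrite mxE eq_sym (negbTE ji) mul0r scale0r.
Qed.

Lemma mean_curvature_wave_immersion x : mean_curvature u x = 0.
Proof.
rewrite /mean_curvature first_form_wave_immersion invmx1.
transitivity (\sum_i normal_part u x (partial_map i (partial_map i u) x)).
  apply: eq_bigr => i _; rewrite (bigD1 i) //= mxE eqxx scale1r big1 ?addr0 // => j ji.
  by rewrite mxE eq_sym (negbTE ji) scale0r.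
under eq_bigr do rewrite normal_part_wave_immersion.
rewrite !sumrB laplacian_wave_immersion.
rewrite exchange_big /= [X in _ - X]big1 => [|j _]; last first.
  rewrite -scaler_suml -dot_suml laplacian_wave_immersion dotZl.
  by rewrite dot_wave_immersion_partial mulr0 scale0r.
rewrite subr0 -scaler_suml -dot_suml laplacian_wave_immersion dotZl.
by rewrite dot_wave_immersion mulr1 subrr.
Qed.

Lemma lambda1_minimal_wave_immersion : lambda1_minimal_immersion L u.
Proof.
have eig k : eigenfunction L (lambda1 L) (coordinate u k).
  rewrite coordinate_wave xi_lambda1 -(xi_norm (enum_val k).1).
  by apply: eigenfunction_wave; rewrite ?amplitude_neq0.
split=> //; first split.
- by move=> v Lv x; apply/rowP => k; have [_ per _ _] := eig k; exact: per.
- by move=> k; have [] := eig k.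
- exact: dot_wave_immersion.
- exact: first_form_wave_immersion.
- exact: mean_curvature_wave_immersion.
Qed.

End WaveImmersion.

(** * Lattices and their duals *)

Lemma four_pi_sqr_gt0 (R : realType) : 0 < 4 * pi ^+ 2 :> R.
Proof. by rewrite mulr_gt0 // exprn_gt0 // pi_gt0. Qed.

Section DualLattice.
Context {R : realType} {n : nat}.
Implicit Types (A B D : 'M[R]_n) (v : 'rV[R]_n).

Lemma intmx_of_int v : (forall i, v 0 i \is a Num.int) -> exists z : 'rV[int]_n, v = intmx z.
Proof.
move=> vi; exists (\row_i Num.floor (v 0 i)).
by apply/rowP => i; rewrite !mxE floorK.
Qed.

Lemma lattice_row B i : lattice B (row i B).
Proof. by exists (delta_mx 0 i); exact: row_intmx. Qed.

Lemma dual_latticeE B : B \in unitmx -> dual_lattice (lattice B) = lattice (dual_basis B).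
Proof.
move=> uB; apply/seteqP; split=> v; last first.
  move=> [y ->] _ [z ->]; rewrite dotC dotE trmx_mul mulmxA -(mulmxA _ B).
  rewrite mulmx_tr_dual_basis // mulmx1 mxE.
  by apply: rpred_sum => i _; rewrite !mxE rpredM // rpred_int.
move=> vB; have [i|z zE] := @intmx_of_int (v *m B^T).
  rewrite (_ : (v *m B^T) 0 i = dot v (row i B)); first by apply: vB; exact: lattice_row.
  by rewrite mxE; apply: eq_bigr => k _; rewrite !mxE.
by exists z; rewrite -zE /dual_basis trmx_inv mulmxK // unitmx_tr.
Qed.

Lemma intmx_basis_change A B :
  (forall i, lattice B (row i A)) -> exists Z : 'M[int]_n, A = intmx Z *m B.
Proof.
move=> /choice[z zE]; exists (\matrix_i z i); apply/row_matrixP => i.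
by rewrite row_intmxM rowK zE.
Qed.

Lemma lattice_intmx (Z : 'M[int]_n) B v : lattice (intmx Z *m B) v -> lattice B v.
Proof. by move=> [z ->]; exists (z *m Z); rewrite intmxM mulmxA. Qed.

Lemma eq_lattice_unimodular A B : A \in unitmx -> lattice A = lattice B ->
  exists2 Z : 'M[int]_n, Z \in unitmx & A = intmx Z *m B.
Proof.
move=> uA LAB.
have [|Z AE] := @intmx_basis_change A B; first by rewrite -LAB; exact: lattice_row.
have [|W BE] := @intmx_basis_change B A; first by rewrite LAB; exact: lattice_row.
exists Z => //; suff /mulmx1_unit[] : Z *m W = 1%:M by [].
have : intmx (Z *m W) = 1%:M :> 'M[R]_n.
  by apply: (can_inj (mulmxK uA)); rewrite mul1mx intmxM -mulmxA -BE.
move/matrixP => ZW; apply/matrixP => i j; apply: (intr_inj (R := R)).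
by have := ZW i j; rewrite !mxE; case: eqP.
Qed.

Lemma det_gram_eq_lattice A B :
  A \in unitmx -> lattice A = lattice B -> \det (gram A) = \det (gram B).
Proof. by move=> uA /(eq_lattice_unimodular uA)[Z uZ ->]; rewrite det_gram_intmx. Qed.

Lemma lattice_basis_dual B D : B \in unitmx ->
  lattice_basis (dual_lattice (lattice B)) D -> lattice B = lattice (dual_basis D).
Proof.
move=> uB [uD LD]; rewrite -(dual_latticeE uD) -LD dual_latticeE //.
by rewrite dual_latticeE ?dual_basis_unit // dual_basisK.
Qed.

End DualLattice.

Lemma lambda1_le_lattice_min (R : realType) (n : nat) (B : 'M[R]_n.+1) : B \in unitmx ->
  lambda1 (lattice B) <= 4 * pi ^+ 2 * lattice_min (dual_basis B).
Proof.
move=> uB; have pi2 := four_pi_sqr_gt0 R.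
rewrite -ler_pdivrMl //; apply: le_lattice_min => U uU i; rewrite ler_pdivrMl // gramE.
apply: lambda1_le; last by rewrite unitmx_row_neq0 // unitmx_mul intmx_unit ?dual_basis_unit.
by rewrite dual_latticeE //; apply: lattice_intmx; exact: lattice_row.
Qed.

Lemma lambda1_volE (R : realType) (n : nat) (B : 'M[R]_n.+1) :
  lambda1_vol B = 4 * pi ^+ 2 *
    ((lambda1 (lattice B) / (4 * pi ^+ 2)) ^+ n.+1 * \det (gram B)) `^ (n.+1%:R)^-1.
Proof.
have pi2 := four_pi_sqr_gt0 R.
have m0 : 0 <= lambda1 (lattice B) / (4 * pi ^+ 2) by rewrite divr_ge0 ?lambda1_ge0 // ltW.
rewrite det_gram -[\det B ^+ 2]real_normK ?num_real // powRM ?exprn_ge0 //.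
rewrite -(powR_mulrn _ m0) -(powR_mulrn _ (normr_ge0 _)) -!powRrM divff ?pnatr_eq0 //.
by rewrite powRr1 // mulrA [4 * _ * _]mulrC divfK // gt_eqF.
Qed.

Lemma lambda1_vol_le (R : realType) (n : nat) (B : 'M[R]_n.+1) (gamma : R) : B \in unitmx ->
  lattice_min (dual_basis B) ^+ n.+1 <= gamma * \det (gram (dual_basis B)) ->
  lambda1_vol B <= 4 * pi ^+ 2 * gamma `^ (n.+1%:R)^-1.
Proof.
move=> uB hermite; have pi2 := four_pi_sqr_gt0 R.
have d0 := det_gram_gt0 uB.
have m0 : 0 <= lambda1 (lattice B) / (4 * pi ^+ 2) by rewrite divr_ge0 ?lambda1_ge0 // ltW.
have bound : (lambda1 (lattice B) / (4 * pi ^+ 2)) ^+ n.+1 * \det (gram B) <= gamma.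
  rewrite -ler_pdivlMr // -det_gram_dual_basis; apply: le_trans hermite.
  by rewrite lerXn2r ?nnegrE ?lattice_min_ge0 // ler_pdivrMr // mulrC lambda1_le_lattice_min.
have lhs0 : 0 <= (lambda1 (lattice B) / (4 * pi ^+ 2)) ^+ n.+1 * \det (gram B).
  by rewrite mulr_ge0 ?exprn_ge0 // ltW.
rewrite lambda1_volE ler_pM2l // ge0_ler_powR ?nnegrE //.
by apply: le_trans bound.
Qed.

(** * The duals of the root lattices D_n *)

(* In the orthogonal frame given by the rows of [P], the lattice dual to the
   root lattice D_n: the cubic lattice together with its translate by the half
   sum of the frame. *)
Definition Dn_dual {R : realType} {n : nat} (P : 'M[R]_n) : set 'rV[R]_n :=
  [set v | exists (z : 'rV[int]_n) (e : int), v = (intmx z + const_mx (e%:~R / 2)) *m P].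

Lemma lattice_Dn_dual (R : realType) (n : nat) (B P : 'M[R]_n)
    (X Z : 'M[int]_n) (y : 'rV[int]_n) (e : 'cV[int]_n) :
  P = intmx X *m B -> const_mx 2^-1 *m P = intmx y *m B ->
  B = (intmx Z + intmx e *m const_mx 2^-1) *m P -> lattice B = Dn_dual P.
Proof.
move=> PE halfE BE.
have halfZ (k : int) : const_mx (k%:~R / 2) = k%:~R *: const_mx 2^-1 :> 'rV[R]_n.
  by apply/rowP => i; rewrite !mxE.
apply/seteqP; split=> v [z].
  move=> ->; exists (z *m Z), ((z *m e) 0 0).
  rewrite {1}BE mulmxA mulmxDr mulmxA -!intmxM halfZ.
  by rewrite [intmx (z *m e)]mx11_scalar mul_scalar_mx [intmx _ 0 0]mxE.
move=> [k ->]; exists (z *m X + k *: y).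
rewrite (map_mxD intr) (map_mxZ intr) intmxM !mulmxDl -mulmxA -PE halfZ.
by rewrite -!scalemxAl halfE.
Qed.

Lemma lattice_scale_Dn_dual (R : realType) (n : nat) (B P : 'M[R]_n) (r : R) :
  lattice B = Dn_dual P -> lattice (r *: B) = Dn_dual (r *: P).
Proof.
move=> BP; apply/seteqP; split=> v.
  move=> [z ->]; have : lattice B (intmx z *m B) by exists z.
  by rewrite BP => -[z' [e zB]]; exists z', e; rewrite -!scalemxAr zB.
move=> [z [e ->]]; have : Dn_dual P ((intmx z + const_mx (e%:~R / 2)) *m P) by exists z, e.
by rewrite -BP => -[z' zP]; exists z'; rewrite -!scalemxAr zP.
Qed.

Section DnDual.
Context {R : realType} {n : nat}.
Variables (P : 'M[R]_n.+2) (c : R).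
Hypotheses (c_gt0 : 0 < c) (gram_P : gram P = c%:M).

Let c_neq0 : c != 0. Proof. by rewrite gt_eqF. Qed.

Lemma frame_unit : P \in unitmx.
Proof.
have : gram P \in unitmx by rewrite gram_P unitmxE det_scalar unitrX // unitfE.
by rewrite unitmx_mul => /andP[].
Qed.

Lemma mul_tr_frame : P^T *m P = c%:M.
Proof. by apply: (can_inj (mulKmx frame_unit)); rewrite mulmxA [P *m _]gram_P scalar_mxC. Qed.

Lemma dot_row_frame i j : dot (row i P) (row j P) = c * (i == j)%:R.
Proof. by rewrite -gramE gram_P mxE mulr_natr. Qed.

Lemma dot_row_mulmx_frame (v : 'rV[R]_n.+2) i : dot (row i P) (v *m P) = c * v 0 i.
Proof.
rewrite mulmx_sum_row dot_sumr (bigD1 i) //= dotZr dot_row_frame eqxx mulr1 mulrC.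
rewrite big1 ?addr0 // => j ji.
by rewrite dotZr dot_row_frame eq_sym (negbTE ji) !mulr0.
Qed.

Lemma laplace_eigenvalue_Dn_dual_ge (l : R) : 0 < l ->
  laplace_eigenvalue (Dn_dual P) l -> 8 * pi ^+ 2 / c <= l.
Proof.
move=> l0 [f [sf pf [x fx] lf]]; rewrite ler_pdivrMr // (mulrC l).
pose F (y : 'rV[R]_n.+2) := f (y *m P + 0).
apply: (@half_integral_eigenvalue_ge _ _ F); last by rewrite mulr_gt0.
- exact: helmholtz_affine mul_tr_frame (conj sf lf).
- split=> [z y|y]; rewrite /F !addr0 mulmxDl pf //.
    by exists z, 0; rewrite mul0r raddf0 addr0.
  by exists 0, 1; rewrite mul1r (map_mx0 intr) add0r.
- by exists (x *m invmx P); rewrite /F addr0 mulmxKV // frame_unit.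
Qed.

Local Notation T := ('I_n.+2 * 'I_n.+1 * bool)%type.

Definition Dn_root (t : T) : 'rV[R]_n.+2 :=
  c^-1 *: (row t.1.1 P + (-1) ^+ t.2 *: row (lift t.1.1 t.1.2) P).

Lemma Dn_root_norm t : dot (Dn_root t) (Dn_root t) = 2 / c.
Proof.
rewrite /Dn_root !(dotZl, dotZr, dotDl, dotDr) !dot_row_frame !eqxx.
rewrite [lift _ _ == _]eq_sym !(negbTE (neq_lift _ _)).
by case: t.2; rewrite /= ?expr0 ?expr1; field.
Qed.

Lemma Dn_root_neq0 t : Dn_root t != 0.
Proof. by rewrite -dot_eq0 Dn_root_norm mulf_neq0 ?invr_eq0 ?pnatr_eq0. Qed.

Lemma Dn_root_dual t : dual_lattice (Dn_dual P) (Dn_root t).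
Proof.
move=> _ [z [e ->]]; rewrite /Dn_root dotZl dotDl dotZl !dot_row_mulmx_frame !mxE.
set i := t.1.1; set j := lift _ _.
rewrite (_ : c^-1 * _ = (z 0 i + (-1) ^+ t.2 * z 0 j + (if t.2 then 0 else e))%:~R) ?intr_int //.
by rewrite !intrD; case: t.2; rewrite /= ?expr0 ?expr1 ?mul1r ?mulN1r ?intrN; field.
Qed.

Lemma lambda1_Dn_dual : lambda1 (Dn_dual P) = 8 * pi ^+ 2 / c.
Proof.
pose t : T := (0, 0, false); have [root_dual root_neq0] := (Dn_root_dual t, Dn_root_neq0 t).
apply/eqP; rewrite eq_le; apply/andP; split; last first.
  exact: le_lambda1 root_dual root_neq0 laplace_eigenvalue_Dn_dual_ge.
have := lambda1_le root_dual root_neq0; rewrite Dn_root_norm mulrA.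
by rewrite (_ : 4 * pi ^+ 2 * 2 = 8 * pi ^+ 2) //; ring.
Qed.

Lemma sum_lift_pairs (F : 'I_n.+2 -> R) :
  \sum_i \sum_(k < n.+1) (F i + F (lift i k)) = 2 * n.+1%:R * \sum_i F i.
Proof.
transitivity (\sum_i (n%:R * F i + \sum_j F j)).
  apply: eq_bigr => i _; rewrite big_split /= sumr_const card_ord.
  have -> : \sum_j F j = F i + \sum_(k < n.+1) F (lift i k) by rewrite (bigD1_ord i).
  by rewrite mulrSr mulr_natl addrA.
rewrite big_split /= -mulr_sumr sumr_const card_ord -mulr_natl.
by rewrite -![_.+1%:R]natr1; ring.
Qed.

Lemma Dn_root_tight i j : 4 * pi ^+ 2 * \sum_t Dn_root t 0 i * Dn_root t 0 j =
  8 * pi ^+ 2 / c * (2 * n.+1%:R * (i == j)%:R).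
Proof.
have PC : \sum_k P k i * P k j = c * (i == j)%:R.
  have := mul_tr_frame => /matrixP/(_ i j); rewrite !mxE mulr_natr => <-.
  by apply: eq_bigr => k _; rewrite mxE.
have -> : \sum_t Dn_root t 0 i * Dn_root t 0 j =
    2 / c ^+ 2 * \sum_i' \sum_(k < n.+1) (P i' i * P i' j + P (lift i' k) i * P (lift i' k) j).
  rewrite -(pair_bigA _ (fun tt b => Dn_root (tt, b) 0 i * Dn_root (tt, b) 0 j)) /=.
  rewrite -(pair_bigA _ (fun i' k => \sum_b Dn_root (i', k, b) 0 i * Dn_root (i', k, b) 0 j)) /=.
  rewrite mulr_sumr; apply: eq_bigr => i' _; rewrite mulr_sumr; apply: eq_bigr => k _.
  by rewrite big_bool /= !mxE /= expr1 expr0; field.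
by rewrite (sum_lift_pairs (fun a => P a i * P a j)) PC; field.
Qed.

Lemma lambda1_minimal_Dn_root_immersion : c = 8 * pi ^+ 2 / n.+2%:R ->
  lambda1_minimal_immersion (Dn_dual P) (wave_immersion Dn_root).
Proof.
move=> cE; apply: (@lambda1_minimal_wave_immersion _ _ _ _ _ (2 / c) (0, 0, false)).
- exact: Dn_root_dual.
- exact: Dn_root_neq0.
- exact: Dn_root_norm.
- by rewrite lambda1_Dn_dual; field.
move=> i j; rewrite Dn_root_tight !card_prod !card_ord card_bool mulrA; congr (_ * _).
have -> : 8 * pi ^+ 2 / c = n.+2%:R.
  rewrite cE divKf // mulf_neq0 ?pnatr_eq0 // expf_neq0 // gt_eqF //; exact: pi_gt0.
by rewrite !natrM; ring.
Qed.

End DnDual.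

Lemma lambda1_minimal_Dn_dual (R : realType) (n : nat) (B P : 'M[R]_n.+2) (c : R) :
  0 < c -> gram P = c%:M -> lattice B = Dn_dual P -> lambda1_minimal B.
Proof.
move=> c0 gramP BP; pose r := Num.sqrt (8 * pi ^+ 2 / n.+2%:R / c).
have r2 : 0 < 8 * pi ^+ 2 / n.+2%:R / c :> R.
  by rewrite !divr_gt0 ?mulr_gt0 ?exprn_gt0 ?pi_gt0.
exists r; split; first by rewrite sqrtr_gt0.
have gram_rP : gram (r *: P) = (8 * pi ^+ 2 / n.+2%:R)%:M.
  by rewrite gramZ gramP scale_scalar_mx sqr_sqrtr ?divfK ?gt_eqF // ltW.
have c'0 : 0 < 8 * pi ^+ 2 / n.+2%:R :> R by rewrite divr_gt0 ?mulr_gt0 ?exprn_gt0 ?pi_gt0.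
exists #|{: ('I_n.+2 * 'I_n.+1 * bool) * bool}|,
  (wave_immersion (Dn_root (r *: P) (8 * pi ^+ 2 / n.+2%:R))).
by rewrite (lattice_scale_Dn_dual r BP); exact: lambda1_minimal_Dn_root_immersion.
Qed.

Lemma lambda1_vol_Dn_dual (R : realType) (n : nat) (B P : 'M[R]_n.+2) (c : R) :
  0 < c -> gram P = c%:M -> lattice B = Dn_dual P ->
  lambda1_vol B = 4 * pi ^+ 2 * ((2 / c) ^+ n.+2 * \det (gram B)) `^ (n.+2%:R)^-1.
Proof.
move=> c0 gramP BP; rewrite lambda1_volE BP (lambda1_Dn_dual c0 gramP).
congr (_ * (_ ^+ _ * _) `^ _); have := gt_eqF (pi_gt0 R).
by move: (pi : R) => p p0; field; rewrite p0 gt_eqF.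
Qed.

(** * The extremal tori *)

Definition int_mx (m n : nat) (s : seq (seq int)) : 'M[int]_(m, n) :=
  \matrix_(i, j) nth 0 (nth [::] s i) j.

Ltac mx_calc := let i := fresh in let j := fresh in let hi := fresh in let hj := fresh in
  apply/matrixP => i j; rewrite !(mxE, big_ord_recl, big_ord0) /=;
  case: i => [[|[|[|[|i]]]] hi] //=; case: j => [[|[|[|[|j]]]] hj] //=;
  rewrite ?(mxE, big_ord_recl, big_ord0) /=; first [by field|lra].

Section Torus3.
Context {R : realType}.

Lemma det_gram3 : \det (gram3 R) = 2^-1.
Proof. by rewrite det_mx33 /= !mxE !inordK //=; field. Qed.

(* Coordinates, in the basis dual to [D], of the edges of a cube. *)
Definition cube3 : 'M[int]_3 := int_mx 3 3 [:: [:: 0; 1; 0]; [:: 1; 0; -1]; [:: 1; -1; 1]].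

Lemma gram_cube3_dual_basis (D : 'M[R]_3) (s : R) :
  D \in unitmx -> 0 < s -> gram D = s *: gram3 R ->
  gram (intmx cube3 *m dual_basis D) = (2 / s)%:M.
Proof.
move=> uD s0 gramD; have s_neq0 : s != 0 by rewrite gt_eqF.
pose cogram3 : 'M[R]_3 := seqs_mx 3 [:: [:: 3 / 2; 1; 1 / 2]; [:: 1; 2; 1]; [:: 1 / 2; 1; 3 / 2]].
have gram3K : gram3 R *m cogram3 = 1%:M by mx_calc.
rewrite gram_mull; have -> : gram (dual_basis D) = s^-1 *: cogram3.
  rewrite gram_dual_basis //; apply: (can_inj (mulKmx (gram_unit uD))).
  by rewrite mulmxV ?gram_unit // gramD -scalemxAl -scalemxAr gram3K scalerA divff // scale1r.
rewrite -scalemxAr -scalemxAl.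
have -> : intmx cube3 *m cogram3 *m (intmx cube3)^T = 2%:M by mx_calc.
by rewrite scale_scalar_mx mulrC.
Qed.

Lemma lattice_dual_basis_cube3 (D : 'M[R]_3) :
  lattice (dual_basis D) = Dn_dual (intmx cube3 *m dual_basis D).
Proof.
apply: (@lattice_Dn_dual _ _ _ _ cube3
  (int_mx 3 3 [:: [:: 0; 0; 0]; [:: 1; 0; 0]; [:: 0; -1; 0]])
  (int_mx 1 3 [:: [:: 1; 0; 0]]) (int_mx 3 1 [:: [:: 1]; [:: 0]; [:: 1]])) => //.
  by rewrite mulmxA; congr (_ *m _); mx_calc.
by rewrite mulmxA -[LHS]mul1mx; congr (_ *m _); mx_calc.
Qed.

Lemma lambda1_vol3_le (B : 'M[R]_3) : B \in unitmx ->
  lambda1_vol B <= 4 * 2 `^ (1 / 3) * pi ^+ 2.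
Proof.
move=> uB; rewrite mulrAC div1r; apply: lambda1_vol_le => //.
by rewrite hermite_rank3 // gram_unit // dual_basis_unit.
Qed.

Lemma exists_dual_gram3 : exists B : 'M[R]_3, B \in unitmx /\ dual_has_gram B (gram3 R).
Proof.
(* Simple roots of D_3 = A_3. *)
pose D : 'M[R]_3 := intmx (int_mx 3 3 [:: [:: 1; -1; 0]; [:: 0; 1; -1]; [:: -1; -1; 0]]).
have gramD : gram D = 2 *: gram3 R by mx_calc.
have uD : D \in unitmx.
  rewrite unitmxE unitfE -sqrf_eq0 -det_gram gramD detZ det_gram3.
  by rewrite mulf_neq0 ?expf_neq0 ?invr_eq0 ?pnatr_eq0.
exists (dual_basis D); split; first exact: dual_basis_unit.
exists D; split; last by exists 2.
by split=> //; rewrite dual_latticeE ?dual_basis_unit // dual_basisK.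
Qed.

Lemma dual_gram3_extremal (B : 'M[R]_3) : B \in unitmx -> dual_has_gram B (gram3 R) ->
  lambda1_minimal B /\ lambda1_vol B = 4 * 2 `^ (1 / 3) * pi ^+ 2.
Proof.
move=> uB [D [basisD [s [s0 gramD]]]]; have [uD _] := basisD.
have c0 : 0 < 2 / s by rewrite divr_gt0.
have gramP := gram_cube3_dual_basis uD s0 gramD.
have latticeB := lattice_basis_dual uB basisD.
have BP := etrans latticeB (lattice_dual_basis_cube3 D).
split; first exact: lambda1_minimal_Dn_dual c0 gramP BP.
rewrite (lambda1_vol_Dn_dual c0 gramP BP) (det_gram_eq_lattice uB latticeB).
rewrite det_gram_dual_basis [gram D]gramD detZ det_gram3 mulrAC div1r; congr (_ * _ `^ _ * _).
by field; rewrite gt_eqF.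
Qed.

End Torus3.

Section Torus4.
Context {R : realType}.

Lemma det_basis4 : \det (basis4 R) = 2.
Proof.
rewrite -det_tr det_trig.
  by rewrite !big_ord_recl big_ord0 !mxE /= !mul1r mulr1.
apply/is_trig_mxP => i j; rewrite !mxE.
by case: i => [[|[|[|[|i]]]] hi] //=; case: j => [[|[|[|[|j]]]] hj].
Qed.

Lemma basis4_unit : basis4 R \in unitmx.
Proof. by rewrite unitmxE det_basis4 unitfE pnatr_eq0. Qed.

Definition cube4 : 'M[int]_4 := int_mx 4 4
  [:: [:: 1; 1; 0; 0]; [:: 1; -1; 0; 0]; [:: 0; 0; 1; 1]; [:: 0; 0; 1; -1]].

Lemma gram_cube4 : gram (intmx cube4) = 2%:M :> 'M[R]_4.
Proof. by mx_calc. Qed.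

Lemma lattice_basis4 : lattice (basis4 R) = Dn_dual (intmx cube4).
Proof.
apply: (@lattice_Dn_dual _ _ _ _
  (int_mx 4 4 [:: [:: 1; 1; 0; 1]; [:: 1; -1; 0; 0]; [:: 0; 0; 1; 1]; [:: 0; 0; 1; 0]])
  (int_mx 4 4 [:: [:: 0; 0; -1; 0]; [:: 0; -1; -1; 0]; [:: 0; 0; 0; 1]; [:: 0; 0; 1; -1]])
  (int_mx 1 4 [:: [:: 1; 0; 1; 1]]) (int_mx 4 1 [:: [:: 1]; [:: 1]; [:: 0]; [:: 0]])); mx_calc.
Qed.

Lemma powR_quarter : 4 `^ 4^-1 = Num.sqrt 2 :> R.
Proof.
rewrite {1}(_ : 4 = 2 `^ 2%:R); last by rewrite powR_mulrn //; ring.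
by rewrite -powRrM -powR12_sqrt //; congr (_ `^ _); field.
Qed.

Lemma lambda1_vol4_le (B : 'M[R]_4) : B \in unitmx ->
  lambda1_vol B <= 4 * Num.sqrt 2 * pi ^+ 2.
Proof.
move=> uB; rewrite mulrAC -powR_quarter; apply: lambda1_vol_le => //.
by rewrite hermite_rank4 // dual_basis_unit.
Qed.

Lemma basis4_extremal (r : R) : 0 < r -> lambda1_minimal (r *: basis4 R) /\
  lambda1_vol (r *: basis4 R) = 4 * Num.sqrt 2 * pi ^+ 2.
Proof.
move=> r0; have BP := lattice_scale_Dn_dual r lattice_basis4.
have c0 : 0 < r ^+ 2 * 2 by rewrite mulr_gt0 // exprn_gt0.
have gramP : gram (r *: intmx cube4) = (r ^+ 2 * 2)%:M.
  by rewrite gramZ gram_cube4 scale_scalar_mx.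
split; first exact: lambda1_minimal_Dn_dual c0 gramP BP.
rewrite (lambda1_vol_Dn_dual c0 gramP BP) det_gram detZ det_basis4 mulrAC -powR_quarter.
by congr (_ * _ `^ _ * _); field; rewrite gt_eqF.
Qed.

End Torus4.

Theorem theorem1 (R : realType) :
  ((forall B : 'M[R]_3, B \in unitmx ->
      lambda1_vol B <= 4 * 2 `^ (1 / 3) * pi ^+ 2) /\
   (exists B : 'M[R]_3, B \in unitmx /\ dual_has_gram B (gram3 R)) /\
   (forall B : 'M[R]_3, B \in unitmx -> dual_has_gram B (gram3 R) ->
      lambda1_minimal B /\
      lambda1_vol B = 4 * 2 `^ (1 / 3) * pi ^+ 2))
  /\
  ((forall B : 'M[R]_4, B \in unitmx ->
      lambda1_vol B <= 4 * Num.sqrt 2 * pi ^+ 2) /\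
   (basis4 R \in unitmx /\
    forall r : R, 0 < r ->
      lambda1_minimal (r *: basis4 R) /\
      lambda1_vol (r *: basis4 R) = 4 * Num.sqrt 2 * pi ^+ 2)).
Proof.
split; split.
- exact: lambda1_vol3_le.
- by split; [exact: exists_dual_gram3|exact: dual_gram3_extremal].
- exact: lambda1_vol4_le.
- by split; [exact: basis4_unit|exact: basis4_extremal].
Qed.
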